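(* Let $(R,\mathfrak m)$ be a one-dimensional Cohen–Macaulay local ring with a canonical ideal, and assume $R$ is not Gorenstein. Let $A=R\ltimes\mathfrak m$. Then $$\mathrm{bideg}(A)=2\,\mathrm{bideg}(R)-1.$$ In particular, if $R$ is a Goto ring, then $A$ is also a Goto ring.
   Context: $R\ltimes \mathfrak m=R\oplus\mathfrak m\epsilon$, $\epsilon^2=0$, is the idealization of the $R$-module $\mathfrak m$ over $R$, i.e. multiplication is $(a,m)(b,n)=(ab,an+bm)$. A canonical ideal is an ideal isomorphic to a canonical module. For a one-dimensional Cohen–Macaulay local ring $B$ with canonical ideal $D$, $\mathrm{bideg}(B)=\lambda_B(D^{**}/D)$, where $(-)^*=\mathrm{Hom}_B(-,B)$ and $D$ is embedded naturally in its bidual; this does not depend on the choice of $D$. A Cohen–Macaulay local ring is a Goto ring if it has a canonical ideal and its $\mathrm{bideg}$ equals $1$. *)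

(* Defs.v *)
(* boolp turns arbitrary subsets into boolean predicates (so that every
   submodule is a [submodClosed]) and gives modules of homomorphisms a
   choiceType structure. *)
From HB Require Import structures.
From mathcomp Require Import all_boot all_algebra.
From mathcomp Require Import boolp.

Set Implicit Arguments.
Unset Strict Implicit.
Unset Printing Implicit Defensive.

Import GRing.Theory.

Local Open Scope ring_scope.
Local Open Scope quotient_scope.

Notation ideal R := (@submodClosed R (R : comNzRingType)^o).

Definition submod_sub (R : comNzRingType) (V : lmodType R) (S T : submodClosed V) :
  Prop := forall x, x \in S -> x \in T.

Definition submod_eq (R : comNzRingType) (V : lmodType R) (S T : submodClosed V) :
  Prop := forall x, (x \in S) = (x \in T).

Section SubmoduleType.
Variables (R : comNzRingType) (V : lmodType R) (S : submodClosed V).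

Record submod := Submod { submod_val : V; submod_valP : submod_val \in S }.

HB.instance Definition _ := [isSub for submod_val].
HB.instance Definition _ := [Choice of submod by <:].
HB.instance Definition _ := [SubChoice_isSubLmodule of submod by <:].

End SubmoduleType.

(* The quotient module [V / S]; mathcomp's [Quotient.quot] only provides the
   underlying group. *)
Section QuotientModule.
Variables (R : comNzRingType) (V : lmodType R) (S : submodClosed V).

Definition subgroup_of : {pred V} := S.

Lemma subgroup_of_closed : zmod_closed subgroup_of.
Proof. exact: GRing.submod_closedB (submodClosedP S). Qed.

HB.instance Definition _ := GRing.isZmodClosed.Build V subgroup_of
  subgroup_of_closed.

Definition quomod := Quotient.quot subgroup_of.

HB.instance Definition _ := GRing.Zmodule.on quomod.
HB.instance Definition _ := Quotient.on quomod.

Definition quomod_scale (a : R) (x : quomod) : quomod :=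
  \pi_quomod (a *: repr x).

Lemma quomod_eq (x y : V) : (\pi_quomod x = \pi_quomod y) <-> (x - y \in S).
Proof.
rewrite -[x - y \in S]/(x - y \in (subgroup_of : zmodClosed V)).
by rewrite Quotient.idealrBE; split=> /eqP.
Qed.

Lemma quomod_piD (x y : V) : \pi_quomod (x + y) = \pi_quomod x + \pi_quomod y.
Proof. by rewrite [LHS](Quotient.pi_add subgroup_of). Qed.

Lemma quomod_scale_pi a (x : V) :
  quomod_scale a (\pi_quomod x) = \pi_quomod (a *: x).
Proof.
apply/quomod_eq; rewrite -scalerBr rpredZ //.
by apply/quomod_eq; rewrite reprK.
Qed.

Lemma quomod_ind (P : quomod -> Prop) :
  (forall x, P (\pi_quomod x)) -> forall x, P x.
Proof. by move=> H x; rewrite -[x]reprK; apply: H. Qed.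

Lemma quomod_scaleA a b x :
  quomod_scale a (quomod_scale b x) = quomod_scale (a * b) x.
Proof. by elim/quomod_ind: x => x; rewrite !quomod_scale_pi scalerA. Qed.

Lemma quomod_scale1 : left_id 1 quomod_scale.
Proof. by elim/quomod_ind => x; rewrite quomod_scale_pi scale1r. Qed.

Lemma quomod_scaleDr : right_distributive quomod_scale +%R.
Proof.
move=> a; elim/quomod_ind => x; elim/quomod_ind => y.
by rewrite -quomod_piD !quomod_scale_pi scalerDr quomod_piD.
Qed.

Lemma quomod_scaleDl v : {morph quomod_scale^~ v : a b / a + b}.
Proof.
elim/quomod_ind: v => v a b.
by rewrite !quomod_scale_pi scalerDl quomod_piD.
Qed.

HB.instance Definition _ := GRing.Zmodule_isLmodule.Build R quomod
  quomod_scaleA quomod_scale1 quomod_scaleDr quomod_scaleDl.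

End QuotientModule.

Section HomModule.
Variables (R : comNzRingType) (V W : lmodType R).

Definition Hom := {linear V -> W}.

HB.instance Definition _ := gen_eqMixin Hom.
HB.instance Definition _ := gen_choiceMixin Hom.

Lemma Hom_ext (f g : Hom) : (forall x, f x = g x) -> f = g.
Proof.
case: f g => [f [[cf] [sf]]] [g [[cg] [sg]]] /= /funext fg; subst g.
by rewrite (Prop_irrelevance cf cg) (Prop_irrelevance sf sg).
Qed.

Definition Hom_zero : Hom := [the {linear V -> W} of \0%R].
Definition Hom_add (f g : Hom) : Hom := [the {linear V -> W} of f \+ g].
Definition Hom_opp (f : Hom) : Hom := [the {linear V -> W} of \- f].
Definition Hom_scale (a : R) (f : Hom) : Hom := [the {linear V -> W} of a \*: f].

Lemma Hom_addA : associative Hom_add.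
Proof. by move=> f g h; apply: Hom_ext => x /=; rewrite addrA. Qed.
Lemma Hom_addC : commutative Hom_add.
Proof. by move=> f g; apply: Hom_ext => x /=; rewrite addrC. Qed.
Lemma Hom_add0 : left_id Hom_zero Hom_add.
Proof. by move=> f; apply: Hom_ext => x /=; rewrite add0r. Qed.
Lemma Hom_addN : left_inverse Hom_zero Hom_opp Hom_add.
Proof. by move=> f; apply: Hom_ext => x /=; rewrite addNr. Qed.

HB.instance Definition _ :=
  GRing.isZmodule.Build Hom Hom_addA Hom_addC Hom_add0 Hom_addN.

Lemma Hom_scaleA a b f : Hom_scale a (Hom_scale b f) = Hom_scale (a * b) f.
Proof. by apply: Hom_ext => x /=; rewrite scalerA. Qed.
Lemma Hom_scale1 : left_id 1 Hom_scale.
Proof. by move=> f; apply: Hom_ext => x /=; rewrite scale1r. Qed.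
Lemma Hom_scaleDr : right_distributive Hom_scale +%R.
Proof. by move=> a f g; apply: Hom_ext => x /=; rewrite scalerDr. Qed.
Lemma Hom_scaleDl f : {morph Hom_scale^~ f : a b / a + b}.
Proof. by move=> a b; apply: Hom_ext => x /=; rewrite scalerDl. Qed.

HB.instance Definition _ := GRing.Zmodule_isLmodule.Build R Hom
  Hom_scaleA Hom_scale1 Hom_scaleDr Hom_scaleDl.

End HomModule.

Definition dual (R : comNzRingType) (V : lmodType R) : lmodType R := Hom V R^o.

Section PropSubmodule.
Variables (R : comNzRingType) (V : lmodType R) (P : V -> Prop).

Definition prop_submod_closed : Prop :=
  P 0 /\ forall (a : R) (x y : V), P x -> P y -> P (a *: x + y).

Hypothesis P_closed : prop_submod_closed.

Definition prop_pred of prop_submod_closed : {pred V} := fun x => `[< P x >].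

Lemma prop_predP : submod_closed (prop_pred P_closed).
Proof.
case: (P_closed) => P0 PD; split; first exact/asboolP.
by move=> a x y /asboolP Px /asboolP Py; apply/asboolP; apply: PD.
Qed.

HB.instance Definition _ := GRing.isSubmodClosed.Build R V (prop_pred P_closed)
  (GRing.submod_closed_semi prop_predP).

Definition prop_submod : submodClosed V := prop_pred P_closed.

End PropSubmodule.

Section Image.
Variables (R : comNzRingType) (V W : lmodType R) (f : {linear V -> W}).

Lemma image_closed : prop_submod_closed (fun y : W => exists x, y = f x).
Proof.
split; first by exists 0; rewrite linear0.
by move=> a _ _ [x ->] [y ->]; exists (a *: x + y); rewrite linearP.
Qed.

Definition submod_image : submodClosed W := prop_submod image_closed.

End Image.

Section Bidual.
Variables (R : comNzRingType) (V : lmodType R).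

Definition bidual_eval (x : V) (f : dual V) : R^o := f x.

Lemma bidual_eval_linear x : linear (bidual_eval x).
Proof. by []. Qed.
HB.instance Definition _ x := GRing.isLinear.Build R (dual V) R^o *:%R
  (bidual_eval x) (bidual_eval_linear x).

Definition bidual_map (x : V) : dual (dual V) :=
  [the {linear dual V -> R^o} of bidual_eval x].

Lemma bidual_map_linear : linear bidual_map.
Proof. by move=> a x y; apply: Hom_ext => f /=; rewrite /bidual_eval linearP. Qed.
HB.instance Definition _ := GRing.isLinear.Build R V (dual (dual V)) *:%R
  bidual_map bidual_map_linear.

End Bidual.

Definition isomorphic (R : comNzRingType) (V W : lmodType R) : Prop :=
  exists f : {linear V -> W}, bijective f.

Definition has_length (R : comNzRingType) (V : lmodType R) (n : nat) : Prop :=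
  exists S : nat -> submodClosed V,
    [/\ forall x, x \in S 0 -> x = 0,
        forall x, x \in S n
      & forall i, (i < n)%N ->
          [/\ submod_sub (S i) (S i.+1), ~ submod_eq (S i) (S i.+1)
            & forall T : submodClosed V,
                submod_sub (S i) T -> submod_sub T (S i.+1) ->
                submod_eq T (S i) \/ submod_eq T (S i.+1)]].

Definition fin_gen (R : comNzRingType) (V : lmodType R) : Prop :=
  exists (n : nat) (e : 'I_n -> V),
    forall x, exists c : 'I_n -> R, x = \sum_i c i *: e i.

Definition noetherian (R : comNzRingType) : Prop :=
  forall I : ideal R, fin_gen (submod I).

Definition maximal_ideal (R : comNzRingType) (m : ideal R) : Prop :=
  (1 : R) \notin m /\
  forall J : ideal R, submod_sub m J -> (1 : R) \notin J -> submod_eq J m.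

Definition local_ring (R : comNzRingType) (m : ideal R) : Prop :=
  maximal_ideal m /\ forall n : ideal R, maximal_ideal n -> submod_eq n m.

Definition prime_ideal (R : comNzRingType) (P : ideal R) : Prop :=
  (1 : R) \notin P /\ forall a b : R, a * b \in P -> a \in P \/ b \in P.

Definition prime_chain (R : comNzRingType) (n : nat) : Prop :=
  exists P : nat -> ideal R,
    (forall i, (i <= n)%N -> prime_ideal (P i)) /\
    (forall i, (i < n)%N ->
       submod_sub (P i) (P i.+1) /\ ~ submod_eq (P i) (P i.+1)).

Definition krull_dim (R : comNzRingType) (d : nat) : Prop :=
  prime_chain R d /\ forall n, prime_chain R n -> (n <= d)%N.

Definition in_smul (R : comNzRingType) (V : lmodType R) (s : seq R) (y : V) :
  Prop := exists c : 'I_(size s) -> V, y = \sum_(i < size s) s`_i *: c i.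

Definition regular_sequence (R : comNzRingType) (V : lmodType R) (s : seq R) :
  Prop :=
  (forall i, (i < size s)%N -> forall y : V,
     in_smul (take i s) (s`_i *: y) -> in_smul (take i s) y) /\
  exists y : V, ~ in_smul s y.

(* Depth of [V] over a local ring with maximal ideal [m]: the largest length of
   a [V]-regular sequence in [m]. *)
Definition depth (R : comNzRingType) (m : ideal R) (V : lmodType R) (t : nat) :
  Prop :=
  (exists s : seq R,
     [/\ {subset s <= m}, regular_sequence V s & size s = t]) /\
  (forall s : seq R,
     {subset s <= m} -> regular_sequence V s -> (size s <= t)%N).

Definition cohen_macaulay (R : comNzRingType) (m : ideal R) (d : nat) : Prop :=
  [/\ local_ring m, noetherian R, krull_dim R d & depth m R^o d].

Definition injective_module (R : comNzRingType) (E : lmodType R) : Prop :=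
  forall (U V : lmodType R) (f : {linear U -> V}) (g : {linear U -> E}),
    injective f -> exists h : {linear V -> E}, forall x, h (f x) = g x.

Record inj_resolution (R : comNzRingType) (V : lmodType R) := InjResolution {
  res_term :> nat -> lmodType R;
  res_aug : {linear V -> res_term 0};
  res_diff : forall i, {linear res_term i -> res_term i.+1};
  res_injective : forall i, injective_module (res_term i);
  res_aug_inj : injective res_aug;
  res_exact0 : forall x, res_diff 0 x = 0 <-> exists y, x = res_aug y;
  res_exact : forall i x, res_diff i.+1 x = 0 <-> exists y, x = res_diff i y
}.

Definition finite_injdim (R : comNzRingType) (V : lmodType R) : Prop :=
  exists (I : inj_resolution V) (n : nat),
    forall i, (n < i)%N -> forall x : I i, x = 0.

(* The definition of Gorenstein for a Noetherian local ring [R]. *)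
Definition gorenstein (R : comNzRingType) : Prop := finite_injdim R^o.

(* [Ext I M n] is Ext^n_R(M, V), the [n]-th cohomology of Hom_R(M, I), for an
   injective resolution [I] of [V]. *)
Section Ext.
Variables (R : comNzRingType) (V : lmodType R) (I : inj_resolution V).
Variables (M : lmodType R) (n : nat).

Lemma cocycles_closed :
  prop_submod_closed (fun f : Hom M (I n) => forall x, res_diff I n (f x) = 0).
Proof.
split=> [x|a f g f0 g0 x] /=; first by rewrite linear0.
by rewrite linearP f0 g0 scaler0 addr0.
Qed.

Definition cocycles : submodClosed (Hom M (I n)) := prop_submod cocycles_closed.

Definition is_coboundary : Hom M (I n) -> Prop :=
  match n return Hom M (I n) -> Prop with
  | 0 => fun f => f = 0
  | k.+1 => fun f => exists g : Hom M (I k), forall x, f x = res_diff I k (g x)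
  end.

Lemma is_coboundary_closed : prop_submod_closed is_coboundary.
Proof.
rewrite /is_coboundary; case: n => [|k]; split=> //.
- by move=> a _ _ -> ->; rewrite scaler0 addr0.
- by exists 0 => x /=; rewrite linear0.
- move=> a f g [f' Hf] [g' Hg]; exists (a *: f' + g') => x /=.
  by rewrite linearP -Hf -Hg.
Qed.

Lemma coboundaries_closed :
  prop_submod_closed (fun f : submod cocycles => is_coboundary (val f)).
Proof.
have [C0 CD] := is_coboundary_closed; split=> [|a f g Hf Hg].
  by rewrite raddf0.
by rewrite linearP; apply: CD.
Qed.

Definition coboundaries : submodClosed (submod cocycles) :=
  prop_submod coboundaries_closed.

Definition Ext : lmodType R := quomod coboundaries.

End Ext.

(* [V] has type [r] over the local ring with maximal ideal [m]: with
   [k = R / m] and [t] the depth of [V], Ext^t(k, V) is [r]-dimensional over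
   [k], that is, isomorphic to [k ^ r]. *)
Definition has_type (R : comNzRingType) (m : ideal R) (V : lmodType R)
    (r : nat) : Prop :=
  exists (t : nat) (I : inj_resolution V),
    depth m V t /\ isomorphic (Ext I (quomod m) t) {ffun 'I_r -> quomod m}.

(* Bruns-Herzog, Definition 3.3.1: over a Cohen-Macaulay local ring, a canonical
   module is a maximal Cohen-Macaulay module of type 1 and of finite injective
   dimension. *)
Definition canonical_module (R : comNzRingType) (m : ideal R) (C : lmodType R) :
  Prop :=
  [/\ fin_gen C, exists d, krull_dim R d /\ depth m C d, has_type m C 1
    & finite_injdim C].

Definition canonical_ideal (R : comNzRingType) (m D : ideal R) : Prop :=
  exists C : lmodType R, canonical_module m C /\ isomorphic (submod D) C.

(* [bideg B n]: [B] is a one-dimensional Cohen-Macaulay local ring which has a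
   canonical ideal, and the length of [D** / D] is [n], whatever the canonical
   ideal [D]. *)
Definition bideg (B : comNzRingType) (n : nat) : Prop :=
  exists m : ideal B,
    [/\ cohen_macaulay m 1, exists D, canonical_ideal m D
      & forall D, canonical_ideal m D ->
          has_length (quomod (submod_image (@bidual_map B (submod D)))) n].

Definition goto_ring (B : comNzRingType) : Prop := bideg B 1.

Definition idealization (R : comNzRingType) (M : lmodType R) : Type :=
  (R * M)%type.

Section Idealization.
Variables (R : comNzRingType) (M : lmodType R).

Local Notation A := (idealization M).

HB.instance Definition _ := GRing.Zmodule.copy A (R * M)%type.

Definition idealization_one : A := (1, 0).
Definition idealization_mul (x y : A) : A :=
  (x.1 * y.1, x.1 *: y.2 + y.1 *: x.2).

Lemma idealization_mulA : associative idealization_mul.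
Proof.
move=> [a x] [b y] [c z]; congr pair => /=; first by rewrite mulrA.
by rewrite !scalerDr !scalerA addrA (mulrC c a) (mulrC c b) mulrC.
Qed.

Lemma idealization_mulC : commutative idealization_mul.
Proof. by move=> [a x] [b y]; congr pair => /=; rewrite 1?mulrC 1?addrC. Qed.

Lemma idealization_mul1 : left_id idealization_one idealization_mul.
Proof.
by move=> [a x]; congr pair => /=; rewrite ?mul1r // scale1r scaler0 addr0.
Qed.

Lemma idealization_mulDl : left_distributive idealization_mul +%R.
Proof.
move=> [a x] [b y] [c z]; congr pair => /=; first by rewrite mulrDl.
by rewrite scalerDl scalerDr addrACA.
Qed.

Lemma idealization_one_neq0 : idealization_one != 0 :> A.
Proof. by apply/eqP => -[] /eqP; rewrite oner_eq0. Qed.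

HB.instance Definition _ := GRing.Zmodule_isComNzRing.Build A
  idealization_mulA idealization_mulC idealization_mul1 idealization_mulDl
  idealization_one_neq0.

End Idealization.

(* Main.v *)
From HB Require Import structures.
From mathcomp Require Import all_boot all_algebra.
From mathcomp Require Import boolp classical_sets.
From mathcomp Require Import ring zify.
Require Import Defs.

Set Implicit Arguments.
Unset Strict Implicit.
Unset Printing Implicit Defensive.

Import GRing.Theory.
Local Open Scope ring_scope.
Local Open Scope quotient_scope.

(** Write [m] for the maximal ideal of [R], [K] for a canonical ideal, [Q] for
    the total ring of fractions and [I : J] for quotients in [Q]. The canonical
    module of [A = R + m eps] is [Hom_R (A, K)], which is the ideal
    [D = L + K eps] with [L = K : m], once [K] has been multiplied by a
    nonzerodivisor of [m]. Since [K] is not principal, no product of an element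
    of [R : K] by an element of [K] is a unit, and [K] is not reflexive; as
    [L / K] is the simple socle of [Q / K], this puts [L] inside the bidual [J]
    of [K], so [R : L = R : K]. A direct computation then gives
    [A : D = (R : K) + (R : K) eps] and [D** = J + J eps]; what has to be checked
    is that certain products which lie in [R] lie in [m], and each failure would
    make [K] principal or give [R : m = R]. Thus [D** / D] has length
    [l (J / L) + l (J / K) = (r - 1) + r], where [r = l (J / K)] is the bidegree
    of [R].

    Two facts on canonical ideals support this. Firstly, canonical modules are
    given by homological conditions, which have to be made explicit. In a
    one-dimensional Cohen-Macaulay local ring every prime [P] other than [m] is
    the annihilator of an element, so [R / P] embeds into [R], and [R / m] embeds
    into [R / x R] for [x] a nonzerodivisor of [m]. Hence [Ext^1 (R / P, Z) = 0]
    for all primes whenever [Z] is divisible and of injective dimension at most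
    one, and Baer's criterion ([baer]) shows that [Z] is injective
    ([divisible_kernel_injective]). Applied from the end of a finite injective
    resolution of [K], this leaves a resolution [K -> E -> Z] of length one
    ([resolution_ses]). The type of [K] becomes a statement on elements of [E]
    ([socle_generator_of_ext1], [ext1_of_socle_generator]), so a canonical ideal is
    described by a [canonical_embedding]. From it one gets
    [K : (K : I) = I] ([canonical_duality]), in particular [K : K = R], and the
    uniqueness of canonical ideals up to isomorphism ([canonical_ideal_unique]);
    it is uniqueness that lets the bidegree be computed with any one canonical
    ideal ([bideg_intro]).

    Secondly, [D] is canonical over [A]: applying [Hom_R (A, -)] to
    [K -> E -> Z] gives a resolution of [D] by injective [A]-modules
    ([coinduced_injective], [pair_ses]) and the extension classes of the residue
    field do not change ([pair_socle_generator]).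

    Fractions are avoided throughout: [I : J] is represented by its multiple by
    a fixed nonzerodivisor, and [R : m] by an element [w] outside [x R] with
    [m w <= x R], which stands for the fraction [w / x] outside [R]. *)

(** * Ideals as predicates *)

Lemma submod_valD (R : comNzRingType) (V : lmodType R) (S : submodClosed V)
  (u v : submod S) : val (u + v) = val u + val v.
Proof. exact: raddfD. Qed.

Lemma submod_valZ (R : comNzRingType) (V : lmodType R) (S : submodClosed V)
  (a : R) (u : submod S) : val (a *: u) = a *: val u.
Proof. by rewrite linearZ. Qed.

Lemma ideal_valZ (R : comNzRingType) (S : ideal R) (a : R) (u : submod S) :
  val (a *: u) = a * val u :> R.
Proof. exact: (@submod_valZ R R^o S a u). Qed.

Lemma ideal_valD (R : comNzRingType) (S : ideal R) (u v : submod S) :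
  val (u + v) = val u + val v :> R.
Proof. exact: (@submod_valD R R^o S u v). Qed.

(** Ideals are handled as plain predicates, which can be modified and compared
    freely; [mk_ideal] turns them into submodules. *)
Definition is_ideal (R : comNzRingType) (I : R -> Prop) : Prop :=
  I 0 /\ forall a x y, I x -> I y -> I (a * x + y).

Section Ideals.
Variable R : comNzRingType.
Implicit Types (I J P : R -> Prop) (x y a : R).

Definition mk_ideal I (idI : is_ideal I) : ideal R := @prop_submod R R^o I idI.

Lemma mk_idealE I (idI : is_ideal I) x : (x \in mk_ideal idI) <-> I x.
Proof. by split=> /asboolP. Qed.

Lemma mem_is_ideal (S : ideal R) : is_ideal (fun x : R => x \in S).
Proof.
split; first exact: (rpred0 S).
by move=> a x y Sx Sy; apply: rpredD => //; apply: (rpredZ a).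
Qed.

Lemma ideal0 I : is_ideal I -> I 0. Proof. by case. Qed.

Lemma idealD I x y : is_ideal I -> I x -> I y -> I (x + y).
Proof. by case=> _ H Ix Iy; rewrite -[x]mul1r; apply: H. Qed.

Lemma idealM I a x : is_ideal I -> I x -> I (a * x).
Proof. by case=> I0 H Ix; rewrite -[a * x]addr0; apply: H. Qed.

Lemma idealMr I a x : is_ideal I -> I x -> I (x * a).
Proof. by rewrite mulrC; apply: idealM. Qed.

Lemma idealN I x : is_ideal I -> I x -> I (- x).
Proof. by move=> idI Ix; rewrite -mulN1r; apply: idealM. Qed.

Lemma idealB I x y : is_ideal I -> I x -> I y -> I (x - y).
Proof. by move=> idI Ix Iy; apply: idealD => //; apply: idealN. Qed.

Definition multiples x : R -> Prop := fun y => exists r, y = r * x.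

Lemma multiples_ideal x : is_ideal (multiples x).
Proof.
split; first by exists 0; rewrite mul0r.
by move=> a _ _ [r ->] [s ->]; exists (a * r + s); ring.
Qed.

Definition colon I y : R -> Prop := fun a => I (a * y).

Lemma colon_ideal I y : is_ideal I -> is_ideal (colon I y).
Proof.
move=> idI; rewrite /colon; split; first by rewrite mul0r; apply: ideal0.
move=> a b c Ib Ic; have -> : (a * b + c) * y = a * (b * y) + c * y by ring.
by apply: (idI.2).
Qed.

Definition adjoin I y : R -> Prop := fun x => exists r i, I i /\ x = r * y + i.

Lemma adjoin_ideal I y : is_ideal I -> is_ideal (adjoin I y).
Proof.
move=> idI; split.
  by exists 0, 0; rewrite mul0r addr0; split=> //; apply: ideal0.
move=> a _ _ [r [i [Ii ->]]] [s [j [Ij ->]]].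
exists (a * r + s), (a * i + j); split; first exact: (idI.2).
ring.
Qed.

Lemma sub_adjoin I y x : I x -> adjoin I y x.
Proof. by move=> Ix; exists 0, x; rewrite mul0r add0r. Qed.

Lemma mem_adjoin I y : is_ideal I -> adjoin I y y.
Proof. by move=> idI; exists 1, 0; rewrite mul1r addr0; split=> //; apply: ideal0. Qed.

Definition is_prime P : Prop :=
  [/\ is_ideal P, ~ P 1 & forall a b, P (a * b) -> P a \/ P b].

Definition regular x : Prop := forall y, x * y = 0 -> y = 0.

Lemma regular_inj x y z : regular x -> x * y = x * z -> y = z.
Proof.
move=> rx e; apply/eqP; rewrite -subr_eq0; apply/eqP/rx.
by rewrite mulrBr e subrr.
Qed.

Lemma regularM x y : regular x -> regular y -> regular (x * y).
Proof. by move=> rx ry z; rewrite -mulrA => /rx /ry. Qed.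

Lemma regularX x n : regular x -> regular (x ^+ n).
Proof.
move=> rx; elim: n => [|n IH]; first by move=> y; rewrite expr0 mul1r.
by rewrite exprS; apply: regularM.
Qed.

Definition faithful I : Prop := forall y, (forall i, I i -> y * i = 0) -> y = 0.

Lemma regular_faithful I x : I x -> regular x -> faithful I.
Proof. by move=> Ix rx y /(_ x Ix); rewrite mulrC => /rx. Qed.

End Ideals.

(** Otherwise choice would give a strictly increasing sequence of ideals, whose
    union is finitely generated. *)
Lemma noetherian_max (R : comNzRingType) (F : (R -> Prop) -> Prop) :
  noetherian R -> (forall I, F I -> is_ideal I) -> (exists I, F I) ->
  exists I, F I /\ forall J, F J -> (forall x, I x -> J x) -> forall x, J x -> I x.
Proof.
move=> noe idF [I0 FI0]; apply: contrapT => nmax.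
have next (I : {I : R -> Prop | F I}) : exists J : {J : R -> Prop | F J},
    (forall x, sval I x -> sval J x) /\ exists x, sval J x /\ ~ sval I x.
  case: I => I FI /=; apply: contrapT => nJ; apply: nmax; exists I; split=> //.
  move=> J FJ IJ x Jx; apply: contrapT => nIx; apply: nJ.
  by exists (exist _ J FJ); split=> //; exists x.
have [f fP] := choice next.
pose c n := sval (iter n f (exist _ I0 FI0)).
have idc n : is_ideal (c n) by apply: idF; apply: svalP.
have cS n x : c n x -> c n.+1 x by apply: (fP _).1.
have c_le n k x : (n <= k)%N -> c n x -> c k x.
  move=> /subnK <-; elim: (k - n)%N => // d IH cx; rewrite addSn; apply: cS.
  exact: IH.
pose U x := exists n, c n x.
have idU : is_ideal U.
  split; first by exists 0%N; apply: ideal0.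
  move=> a x y [n cx] [k cy]; exists (maxn n k).
  by apply: (idc _).2; [apply: c_le cx; apply: leq_maxl
                       |apply: c_le cy; apply: leq_maxr].
have [n [e eP]] := noe (mk_ideal idU).
have /choice[k kP] : forall i, exists k, c k (val (e i)).
  by move=> i; apply/(mk_idealE idU)/valP.
pose N := (\max_i k i)%N.
have ceN i : c N (val (e i)) by apply: c_le (kP i); apply: leq_bigmax.
have [x [cx ncx]] := (fP (iter N f (exist _ I0 FI0))).2.
have Ux : x \in mk_ideal idU by apply/mk_idealE; exists N.+1.
have [a aE] := eP (Submod Ux).
apply: ncx; rewrite -[x]/(val (Submod Ux)) aE raddf_sum.
apply: (big_ind (c N)); [exact: ideal0 (idc N) | | move=> i _].
  by move=> y z; apply: idealD.
exact: (idealM (a i) (idc N) (ceN i)).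
Qed.

(** * One-dimensional local rings *)

(** The consequences of being a one-dimensional Cohen-Macaulay local ring with
    maximal ideal [M] that are used below. *)
Record onedim (R : comNzRingType) (M : R -> Prop) : Prop := Onedim {
  onedim_noetherian : noetherian R;
  onedim_ideal : is_ideal M;
  onedim_one : ~ M 1;
  onedim_unit : forall a, ~ M a -> exists b, a * b = 1;
  onedim_minimal : forall P Q, is_prime P -> is_prime Q -> (forall x, Q x -> P x) ->
    (exists z, M z /\ ~ P z) -> forall x, P x -> Q x;
  onedim_regular : exists x, M x /\ regular x }.

(** Ideals [I : y] with [y] outside [I] that are maximal among those of this
    form are prime; the form [r * y0] keeps track of where [y] comes from. *)
Lemma associated_prime (R : comNzRingType) (I : R -> Prop) (y0 : R) :
  noetherian R -> is_ideal I -> ~ I y0 ->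
  exists r, ~ I (r * y0) /\ is_prime (colon I (r * y0)).
Proof.
move=> noe idI nIy0.
pose F (K : R -> Prop) := exists r, ~ I (r * y0) /\ K = colon I (r * y0).
have [||_ [[r [nIr ->]] rmax]] := @noetherian_max R F noe.
- by move=> _ [r [_ ->]]; apply: colon_ideal.
- by exists (colon I (1 * y0)), 1; rewrite mul1r.
exists r; split=> //; split; rewrite /colon ?mul1r //; first exact: colon_ideal.
move=> a b Iab; have [|nIb] := EM (I (b * (r * y0))); [by right|left].
apply: (rmax (colon I (b * r * y0))).
- by exists (b * r); rewrite -mulrA.
- by rewrite /colon => x Ix; rewrite -mulrA mulrCA; apply: idealM.
- by rewrite /colon -!mulrA mulrA.
Qed.

Section OneDim.
Variables (R : comNzRingType) (M : R -> Prop).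
Hypothesis RM : onedim M.

Implicit Types (I P : R -> Prop) (x y z a : R).

Let noe := onedim_noetherian RM.
Let idM := onedim_ideal RM.

Lemma prime_sub_max P : is_prime P -> forall x, P x -> M x.
Proof.
case=> idP nP1 _ x Px; apply: contrapT => /(onedim_unit RM)[y xy1].
by apply: nP1; rewrite -xy1; apply: idealMr.
Qed.

Lemma nakayama_cyclic a y : M a -> y = a * y -> y = 0.
Proof.
move=> Ma yE; have [|b bE] := onedim_unit RM (a := 1 - a).
  by move=> M1a; apply: (onedim_one RM); rewrite -(subrK a 1); apply: idealD.
by rewrite -[y]mul1r -bE mulrAC mulrBl mul1r -yE subrr mul0r.
Qed.

(** Among the elements that no element outside [P] kills, one with maximal
    annihilator has a prime annihilator; it lies in [P], so it is [P]. *)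
Lemma prime_annihilator P :
  is_prime P -> (exists z, M z /\ ~ P z) ->
  exists y, forall a, P a <-> a * y = 0.
Proof.
move=> [idP nP1 prP] zP.
pose G y := forall s, ~ P s -> s * y <> 0.
pose ann (y a : R) : Prop := a * y = 0.
pose F (K : R -> Prop) := exists y, G y /\ K = ann y.
have id_ann y : is_ideal (ann y).
  rewrite /ann; split=> [|a b c b0 c0]; first by rewrite mul0r.
  by rewrite mulrDl -mulrA b0 mulr0 add0r.
have [||_ [[y [Gy ->]] ymax]] := @noetherian_max R F noe.
- by move=> _ [y [_ ->]].
- exists (ann 1), 1; split=> // s nPs; rewrite mulr1 => s0.
  by apply: nPs; rewrite s0; apply: ideal0.
have pr_ann : is_prime (ann y).
  split=> //; first by apply: Gy.
  rewrite /ann => a b ab0; have [Gb|nGb] := EM (G (b * y)).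
    left; apply: (ymax (ann (b * y))); first by exists (b * y).
      by rewrite /ann => x x0; rewrite mulrCA x0 mulr0.
    by rewrite /ann mulrA.
  right; have [s [nPs s0]] : exists s, ~ P s /\ s * (b * y) = 0.
    apply: contrapT => ns; apply: nGb => s nPs s0; apply: ns.
    by exists s.
  apply: (ymax (ann (s * y))).
  - exists (s * y); split=> // t nPt; rewrite mulrA; apply: Gy => /prP.
    by case.
  - by rewrite /ann => x x0; rewrite mulrCA x0 mulr0.
  - by rewrite /ann mulrCA.
have annP a : ann y a -> P a by move=> a0; apply: contrapT => /Gy.
exists y => a; split; last exact: annP.
exact: (@onedim_minimal _ _ RM P (ann y) (And3 idP nP1 prP) pr_ann annP zP).
Qed.

(** No annihilator of a nonzero element contains [I], and all primes other than
    [M] are such annihilators. *)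
Lemma faithful_prime I P : faithful I -> (forall i, I i -> P i) -> is_prime P ->
  forall z, M z -> P z.
Proof.
move=> fI IP prP z Mz; apply: contrapT => nPz.
have [|y yP] := prime_annihilator prP; first by exists z.
have y0 : y = 0 by apply: fI => i /IP /yP; rewrite mulrC.
by case: prP => _ + _; apply; apply/yP; rewrite y0 mulr0.
Qed.

(** An ideal containing [I] and maximal among those without powers of [z] is
    prime. *)
Lemma faithful_power I z : is_ideal I -> faithful I -> M z ->
  exists n, I (z ^+ n).
Proof.
move=> idI fI Mz; apply: contrapT => nIz.
pose F (K : R -> Prop) :=
  [/\ is_ideal K, forall i, I i -> K i & forall n, ~ K (z ^+ n)].
have [||P [[idP IP nP] Pmax]] := @noetherian_max R F noe.
- by move=> K [].
- by exists I; split=> // n Iz; apply: nIz; exists n.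
suff prP : is_prime P by apply: (nP 1%N); apply: (faithful_prime fI).
split=> //; first by move=> P1; apply: (nP 0%N).
have power a : ~ P a -> exists n, adjoin P a (z ^+ n).
  move=> nPa; apply: contrapT => na; apply: nPa.
  apply: (Pmax (adjoin P a)) (mem_adjoin a idP); last exact: sub_adjoin.
  split; first exact: adjoin_ideal.
  - by move=> i /IP; apply: sub_adjoin.
  - by move=> n an; apply: na; exists n.
move=> a b Pab; apply: contrapT => nab.
have /power[n [r [i [Pi rE]]]] : ~ P a by move=> Pa; apply: nab; left.
have /power[k [s [j [Pj sE]]]] : ~ P b by move=> Pb; apply: nab; right.
apply: (nP (n + k)%N); rewrite exprD rE sE.
have -> : (r * a + i) * (s * b + j) =
    r * s * (a * b) + (s * b + j) * i + r * a * j by ring.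
by apply: idealD => //; [apply: idealD => //|]; apply: idealM.
Qed.

Lemma faithful_regular I : is_ideal I -> faithful I -> exists x, I x /\ regular x.
Proof.
move=> idI fI; have [x [Mx rx]] := onedim_regular RM.
by have [n] := faithful_power idI fI Mx; exists (x ^+ n); split=> //; apply: regularX.
Qed.

(** The associated prime found below [y] contains the faithful ideal [I], so it
    is the maximal ideal. *)
Lemma socle_above I y : is_ideal I -> faithful I -> ~ I y ->
  exists r, ~ I (r * y) /\ forall z, M z -> I (z * (r * y)).
Proof.
move=> idI fI /(associated_prime noe idI)[r [nIr prr]].
exists r; split=> // z Mz; apply: (faithful_prime fI _ prr) => // i Ii.
by rewrite /colon; apply: idealMr.
Qed.

(** The fraction [w / x] is an element of [R : m] outside [R]. *)
Lemma socle_mod_regular x : M x -> regular x ->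
  exists w, ~ multiples x w /\ forall z, M z -> multiples x (z * w).
Proof.
move=> Mx rx; have fx : faithful (multiples x).
  by apply: regular_faithful rx; exists 1; rewrite mul1r.
have [|r [nr rP]] := socle_above (y := 1) (multiples_ideal x) fx.
  move=> [r rE]; apply: (onedim_one RM); rewrite rE; exact: idealM.
by exists (r * 1).
Qed.

(** Nakayama's lemma for [I = x I], without generators: a maximal nonzero
    cyclic subideal [y R] of [I] would be contained in [y' R] with [y = x y']. *)
Lemma divisible_ideal0 (I : R -> Prop) x : M x ->
  (forall y, I y -> exists y', I y' /\ y = x * y') -> forall y, I y -> y = 0.
Proof.
move=> Mx Ix y Iy; apply: contrapT => y0.
pose F (K : R -> Prop) := exists y, [/\ I y, y <> 0 & K = multiples y].
have [||_ [[{y0}y [{}Iy y0 ->]] ymax]] := @noetherian_max R F noe.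
- by move=> _ [a [_ _ ->]]; apply: multiples_ideal.
- by exists (multiples y), y.
have [y' [Iy' yE]] := Ix _ Iy.
have [|||r rE] := ymax (multiples y') _ _ y'.
- exists y'; split=> // y'0; apply: y0; by rewrite yE y'0 mulr0.
- by move=> _ [s ->]; exists (s * x); rewrite yE mulrA.
- by exists 1; rewrite mul1r.
apply: y0; rewrite yE (@nakayama_cyclic (r * x) y') ?mulr0 //; first exact: idealM.
by rewrite -mulrA -yE.
Qed.

End OneDim.

Section LocalRing.
Variables (R : comNzRingType) (m : ideal R).

Lemma local_ring_unit : local_ring m -> noetherian R ->
  forall a : R, a \notin m -> exists b, a * b = 1.
Proof.
move=> [_ locm] noe a am; apply: contrapT => nu.
pose F (K : R -> Prop) := [/\ is_ideal K, K a & ~ K 1].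
have [||K [[idK Ka nK1] Kmax]] := @noetherian_max R F noe.
- by move=> K [].
- exists (multiples a); split; first exact: multiples_ideal.
    by exists 1; rewrite mul1r.
  by case=> b bE; apply: nu; exists b; rewrite mulrC.
have Km : submod_eq (mk_ideal idK) m.
  apply: locm; split; first by apply/negP => /mk_idealE.
  move=> J KJ J1 x; apply/idP/idP => [Jx|/KJ//].
  apply/(mk_idealE idK).
  apply: (Kmax (fun y : R => is_true (y \in J)) _ _ x Jx).
    by split; [exact: mem_is_ideal | apply: KJ; apply/mk_idealE | exact/negP].
  by move=> y Ky; apply: KJ; apply/mk_idealE.
by move/negP: am; apply; rewrite -Km; apply/mk_idealE.
Qed.

Lemma unit_local_ring : (1 : R) \notin m ->
  (forall a : R, a \notin m -> exists b, a * b = 1) -> local_ring m.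
Proof.
move=> m1 um.
have proper (J : ideal R) : (1 : R) \notin J -> submod_sub J m.
  move=> /negP J1 x Jx; apply: contrapT => /negP /um[y xy1].
  by apply: J1; rewrite -xy1; apply: (idealMr y (mem_is_ideal J)).
split; first by split=> // J mJ /proper Jm x; apply/idP/idP; [apply: Jm|apply: mJ].
move=> n [n1 nmax] x; have /nmax -> // := proper n n1.
Qed.

Lemma cohen_macaulay_onedim : cohen_macaulay m 1 -> onedim (fun x : R => x \in m).
Proof.
move=> [locm noe [_ dim1] [[s [sm [sreg _] s1]] _]].
have m1 : (1 : R) \notin m by case: locm => [[]].
have um (a : R) : ~ (a \in m) -> exists b, a * b = 1.
  by move/negP; apply: local_ring_unit.
split=> //; [exact: mem_is_ideal | exact/negP| |].
- move=> P Q [idP nP1 prP] [idQ nQ1 prQ] QP [z [mz nPz]] x Px.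
  have Pm y : P y -> y \in m.
    move=> Py; apply: contrapT => /um[c yc].
    by apply: nP1; rewrite -yc; apply: idealMr.
  apply: contrapT => nQx; suff /dim1 : prime_chain R 2 by [].
  exists (fun i => match i with 0 => mk_ideal idQ | 1 => mk_ideal idP | _ => m end).
  split=> [[|[|i]] _|[|[|i]] // _].
  + split; first by apply/negP => /mk_idealE.
    by move=> a b /mk_idealE/prQ[?|?]; [left|right]; exact: (mk_idealE idQ _).2.
  + split; first by apply/negP => /mk_idealE.
    by move=> a b /mk_idealE/prP[?|?]; [left|right]; exact: (mk_idealE idP _).2.
  + split=> // a b mab; have [|/um[c ac]] := EM (a \in m); [by left|right].
    have -> : b = c * (a * b) by rewrite mulrCA mulrA ac mul1r.
    exact: (idealM c (mem_is_ideal m)).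
  + split=> [y /(mk_idealE idQ)/QP Py|/(_ x) QPx]; first exact: (mk_idealE idP _).2.
    apply: nQx; apply: (mk_idealE idQ _).1; rewrite QPx.
    exact: (mk_idealE idP _).2.
  + split=> [y /(mk_idealE idP)/Pm //|/(_ z) Pmz].
    by apply: nPz; apply: (mk_idealE idP _).1; rewrite Pmz.
- case: s sm sreg s1 => [//|x [|//]] sm sreg _.
  exists x; split; first by apply: sm; rewrite inE.
  move=> y xy0; have [|c] := sreg 0 isT y.
    by exists (fun=> 0); rewrite big_ord0.
  by move=> ->; rewrite big_ord0.
Qed.

End LocalRing.

(** There is no regular sequence [x], [y], since a power of [y] lies in [x R]. *)
Lemma depth_one (R : comNzRingType) (m : ideal R) (V : lmodType R)
    (f : {linear V -> R^o}) :
  onedim (fun x : R => x \in m) -> injective f ->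
  (exists v, regular (f v : R)) -> depth m V 1.
Proof.
move=> Rm injf [v0 rv0].
have f0 v : f v = 0 -> v = 0 by move=> fv0; apply: injf; rewrite fv0 linear0.
split.
  have [x [mx rx]] := onedim_regular Rm.
  exists [:: x]; split=> //; first by move=> y; rewrite inE => /eqP->.
  split=> [[|//] _ y [c]|].
    rewrite big_ord0 /= => xy0; exists (fun=> 0); rewrite big_ord0.
    by apply/f0/rx; rewrite -[x * f y]/(x *: (f y : R^o)) -linearZ xy0 linear0.
  apply: contrapT => nx.
  have div (v : V) : exists w : V, v = x *: w.
    have [[c]|nv] := EM (in_smul [:: x] v).
      by rewrite big_ord1; exists (c ord0).
    by case: nx; exists v.
  suff v00 : (f v0 : R) = 0.
    apply: (onedim_one Rm); rewrite (rv0 1) ?v00 ?mul0r //.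
    exact: (ideal0 (onedim_ideal Rm)).
  apply: (@divisible_ideal0 _ _ Rm (fun y => exists v, y = f v) x) => //.
    move=> _ [v ->]; have [w ->] := div v; exists (f w); split; first by exists w.
    by rewrite linearZ.
  by exists v0.
move=> s sm [sreg [v nv]]; rewrite leqNgt; apply/negP => s2.
case: s s2 sm sreg nv => [|x [|y s]] // _ sm sreg nv.
have rx : regular x.
  move=> a xa0; apply: rv0; suff /f0 av0 : f (a *: v0) = 0.
    by rewrite mulrC -[a * _]/(a *: (f v0 : R^o)) -linearZ av0 linear0.
  have [|c] := sreg 0 isT (a *: v0).
    by exists (fun=> 0); rewrite big_ord0 /= scalerA xa0 scale0r.
  by rewrite big_ord0 => ->; rewrite linear0.
have fx : faithful (multiples x).
  by apply: regular_faithful rx; exists 1; rewrite mul1r.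
have my : y \in m by apply: sm; rewrite !inE eqxx orbT.
have [n [r yE]] := faithful_power Rm (multiples_ideal x) fx my.
have xdiv (v' : V) k : (exists w, y ^+ k *: v' = x *: w) -> exists w, v' = x *: w.
  elim: k v' => [|k IH] v' [w wE]; first by exists w; rewrite -wE scale1r.
  apply: IH; have [|c] := sreg 1 isT (y ^+ k *: v').
    exists (fun=> w); rewrite big_ord1 /= -wE scalerA.
    by rewrite exprS.
  by rewrite big_ord1 /=; exists (c ord0).
have [|w vE] := xdiv v n; first by exists (r *: v); rewrite yE scalerA mulrC.
apply: nv; exists (fun i => if val i == 0 then w else 0).
rewrite /= big_ord_recl /= -vE big1 ?addr0 // => i _.
by rewrite scaler0.
Qed.

Lemma depth_unique (R : comNzRingType) (m : ideal R) (V : lmodType R) t t' :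
  depth m V t -> depth m V t' -> t = t'.
Proof.
move=> [[s [sm sreg <-]] tmax] [[s' [sm' sreg' <-]] tmax'].
by apply/eqP; rewrite eqn_leq tmax' // tmax.
Qed.

(** * Injective modules *)

Section LinearMaps.
Variables (R : comNzRingType) (V W : lmodType R).

Definition mk_linear (f : V -> W) (lf : linear f) : {linear V -> W} :=
  HB.pack_for {linear V -> W} f (GRing.isLinear.Build R V W *:%R f lf).

Lemma bijective_of_inj_surj (f : V -> W) :
  injective f -> (forall y, exists x, f x = y) -> bijective f.
Proof.
move=> injf /choice[g fg]; exists g => // x.
by apply: injf; rewrite fg.
Qed.

End LinearMaps.

Section QuotientLift.
Variables (R : comNzRingType) (V W : lmodType R).
Variables (S : submodClosed V) (g : {linear V -> W}).
Hypothesis g0 : forall x, x \in S -> g x = 0.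

Lemma quomod_lift_linear : linear (fun q : quomod S => g (repr q)).
Proof.
have gpi x : g (repr (\pi_(quomod S) x)) = g x.
  apply/eqP; rewrite -subr_eq0 -linearB; apply/eqP/g0.
  by apply/quomod_eq; rewrite reprK.
move=> a p q; elim/quomod_ind: p => p; elim/quomod_ind: q => q.
rewrite -[a *: _]/(quomod_scale _ _) quomod_scale_pi -quomod_piD !gpi.
by rewrite linearP.
Qed.

Definition quomod_lift := mk_linear quomod_lift_linear.

Lemma quomod_lift_pi x : quomod_lift (\pi_(quomod S) x) = g x.
Proof.
apply/eqP; rewrite /= -subr_eq0 -linearB; apply/eqP/g0.
by apply/quomod_eq; rewrite reprK.
Qed.

End QuotientLift.

Section InjectiveModules.
Variable R : comNzRingType.

(** The form of injectivity used below: the submodule is presented as the image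
    of [p], and [q] is a homomorphism in terms of that presentation. *)
Lemma injective_factor (E T V : lmodType R) (p : {linear T -> V})
    (q : {linear T -> E}) :
  injective_module E -> (forall t, p t = 0 -> q t = 0) ->
  exists h : {linear V -> E}, forall t, h (p t) = q t.
Proof.
move=> injE pq0.
have pq t t' : p t = p t' -> q t = q t'.
  move=> e; apply/eqP; rewrite -subr_eq0 -linearB; apply/eqP/pq0.
  by rewrite linearB e subrr.
pose U := submod (submod_image p).
have inU (u : U) : exists t, val u = p t by apply/asboolP/(valP u).
have [s sP] := choice inU.
have lin : linear (fun u : U => q (s u)).
  move=> a u v; rewrite -linearP; apply: pq; rewrite -sP linearP -!sP.
  by rewrite linearP.
have [h hP] := injE _ _ [the {linear U -> V} of val] (mk_linear lin) val_inj.
exists h => t; have pU : p t \in submod_image p by apply/asboolP; exists t.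
by rewrite -[p t]/(val (Submod pU : U)) hP /=; apply: pq; rewrite -sP.
Qed.

(** Homomorphisms [R / I -> E] defined on the submodule generated by [a]
    extend, read on the images of the generators. *)
Lemma injective_element (E : lmodType R) (I : R -> Prop) (a : R) (e : E) :
  injective_module E -> is_ideal I -> (forall r, I (r * a) -> r *: e = 0) ->
  exists e', a *: e' = e /\ forall i, I i -> i *: e' = 0.
Proof.
move=> injE idI ae; pose T := (R^o * submod (mk_ideal idI))%type.
have linp : linear (fun t : T => t.1 * a + val t.2 : R^o).
  move=> c [r i] [s j].
  change ((c * r + s) * a + (c * val i + val j) =
          c * (r * a + val i) + (s * a + val j) :> R).
  ring.
have linq : linear (fun t : T => (t.1 : R) *: e).
  by move=> c [r i] [s j] /=; rewrite scalerDl scalerA.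
have [|h hP] := @injective_factor _ _ _ (mk_linear linp) (mk_linear linq) injE.
  move=> [r i] /= /eqP; rewrite addr_eq0 => /eqP ra; apply: ae; rewrite ra.
  by apply: idealN => //; apply/(mk_idealE idI)/(valP i).
have h1 (r : R) : r *: h (1 : R) = h (r : R).
  by rewrite -linearZ; congr (h _); rewrite -[_ *: _]/(r * 1) mulr1.
exists (h (1 : R)); split=> [|i Ii]; rewrite h1.
  by have := hP (1, 0); rewrite /= mul1r addr0 scale1r.
by have := hP (0, Submod ((mk_idealE idI i).2 Ii)); rewrite /= mul0r add0r scale0r.
Qed.

Lemma injective_extend_ideal (E : lmodType R) (I : ideal R)
    (f : {linear submod I -> E}) :
  injective_module E -> exists e, forall i, f i = val i *: e.
Proof.
move=> injE.
have [h hP] := injE _ _ [the {linear submod I -> R^o} of val] f val_inj.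
exists (h (1 : R)) => i; rewrite -hP -linearZ; congr (h _).
by rewrite -[_ *: _]/(_ * _ : R) mulr1.
Qed.

(** Zorn's lemma on the graphs of partial extensions; at a maximal graph, the
    criterion extends the homomorphism [r |-> r v] one step further, for any [v]
    outside its domain. *)
Lemma baer (E : lmodType R) :
  (forall (I : R -> Prop) (g : R -> E), is_ideal I ->
    (forall a x y, I x -> I y -> g (a * x + y) = a *: g x + g y) ->
    exists e, forall x, I x -> g x = x *: e) ->
  injective_module E.
Proof.
move=> ext U V f g injf.
(* Nonempty graphs have to contain that of [g]; the empty one is accepted so
   that the union of any chain is again admissible. *)
pose good (G : set (V * E)%type) := [/\
  forall a x y, G x -> G y -> G (a *: x + y),
  forall e, G (0, e) -> e = 0 &
  forall p, G p -> forall u, G (f u, g u)].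
pose base : set (V * E)%type := fun p => exists u, p = (f u, g u).
have gbase : good base.
  split=> [a _ _ [u ->] [v ->]|e [u [u0 ->]]|_ _ u]; last by exists u.
    by exists (a *: u + v); rewrite !linearP.
  by rewrite (injf u 0) ?linear0.
have [|G [[GP G0 Gb] Gmax]] := @Zorn_bigcup _ good.
  move=> F Fgood tot; split.
  - move=> a x y [X FX Xx] [Y FY Yy].
    have [XY|YX] := tot X Y FX FY.
      exists Y => //; have [+ _ _] := Fgood Y FY; apply=> //; exact: XY.
    exists X => //; have [+ _ _] := Fgood X FX; apply=> //; exact: YX.
  - by move=> e [X FX Xe]; have [_ + _] := Fgood X FX; apply.
  - move=> p [X FX Xp] u; exists X => //; have [_ _ +] := Fgood X FX.
    by apply; apply: Xp.
have Gbase u : G (f u, g u).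
  apply: contrapT => nG; apply: (Gmax base) gbase; split=> [p Gp|/(_ (f u, g u))].
    by case: nG; apply: (Gb _ Gp).
  by move=> /(_ (ex_intro _ u erefl)).
have G00 : G (0, 0) by have := Gbase 0; rewrite !linear0.
have Ginj v e e' : G (v, e) -> G (v, e') -> e = e'.
  move=> Ge Ge'; apply/eqP; rewrite eq_sym -subr_eq0; apply/eqP/G0.
  have := GP (-1) _ _ Ge Ge'; rewrite scaleN1r.
  by congr G; apply: injective_projections; rewrite /= addrC ?subrr.
have Gtot v : exists e, G (v, e).
  apply: contrapT => nv.
  pose I (r : R) := exists e, G (r *: v, e).
  have /choice[s sP] : forall r : R, exists e, I r -> G (r *: v, e).
    move=> r; by have [[e Ge]|nr] := EM (I r); [exists e | exists 0].
  have Gcomb a x y : I x -> I y -> G ((a * x + y) *: v, a *: s x + s y).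
    move=> /sP Gx /sP Gy; have := GP a _ _ Gx Gy; congr G.
    by apply: injective_projections => //=; rewrite scalerDl scalerA.
  have idI : is_ideal I.
    split; first by exists 0; rewrite scale0r.
    by move=> a x y Ix Iy; exists (a *: s x + s y); apply: Gcomb.
  have [e eP] : exists e, forall x, I x -> s x = x *: e.
    apply: ext => // a x y Ix Iy; apply: Ginj (Gcomb _ _ _ Ix Iy).
    by apply/sP/(idI.2).
  pose B : set (V * E)%type :=
    fun p => exists r q, G q /\ p = (r *: v + q.1, r *: e + q.2).
  apply: (Gmax B).
    split=> [[x y] Gxy|/(_ (v, e)) BG].
      by exists 0, (x, y); rewrite !scale0r !add0r.
    apply: nv; exists e; apply: BG; exists 1, (0, 0); split=> //.
    by rewrite !scale1r !addr0.
  split.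
  - move=> a _ _ [r [q [Gq ->]]] [r' [q' [Gq' ->]]].
    exists (a * r + r'), (a *: q + q'); split; first exact: GP.
    congr pair; rewrite /= !scalerDr scalerDl scalerA; exact: addrACA.
  - move=> e' [r [[x y] [Gq [/eqP]]]] /=; rewrite eq_sym addr_eq0 => /eqP xE ->.
    have Gr : G (r *: v, - y).
      rewrite xE -!scaleN1r; have := GP (-1) _ _ Gq G00.
      by congr G; apply: injective_projections; rewrite /= addr0.
    have Ir : I r by exists (- y).
    by rewrite -eP // (Ginj _ _ _ (sP _ Ir) Gr) addNr.
  - move=> _ _ u; exists 0, (f u, g u); split; first exact: Gbase.
    by rewrite !scale0r !add0r.
have [h hP] := choice Gtot.
have linh : linear h.
  by move=> a x y; apply: Ginj (hP _) _; have := GP a _ _ (hP x) (hP y).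
by exists (mk_linear linh) => u; apply: Ginj (hP _) (Gbase u).
Qed.

End InjectiveModules.

(** * Canonical modules in dimension one *)

(** [V -> E -> Z] is an injective resolution of length at most one. *)
Definition injective_ses (R : comNzRingType) (V E Z : lmodType R)
    (f : {linear V -> E}) (g : {linear E -> Z}) : Prop :=
  [/\ injective f, injective_module E, injective_module Z,
      forall z, exists e, g e = z & forall e, g e = 0 <-> exists v, e = f v].

Section Kernel.
Variables (R : comNzRingType) (M : R -> Prop) (x : R).
Hypotheses (RM : onedim M) (Mx : M x) (rx : regular x).
Variables (V E Z : lmodType R) (f : {linear V -> E}) (g : {linear E -> Z}).
Hypothesis ses : injective_ses f g.

(** [Ext^1(R / I, V)] is the cokernel of [Hom(R / I, E) -> Hom(R / I, Z)]; this
    says that it vanishes. *)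
Let liftable (I : R -> Prop) := forall z : Z, (forall i, I i -> i *: z = 0) ->
  exists e, g e = z /\ forall i, I i -> i *: e = 0.

(** The sequence [0 -> R / (I : a) -> R / I -> R / (I + a R) -> 0]. *)
Lemma liftable_colon I a :
  is_ideal I -> liftable (colon I a) -> liftable (adjoin I a) -> liftable I.
Proof.
move=> idI la ladj z Iz; have [_ injE _ _ _] := ses.
have [|e [eE e0]] := la (a *: z).
  by move=> r Ir; rewrite scalerA; apply: Iz.
have [|e1 [e1E e10]] := injective_element (e := e) injE idI (a := a).
  by move=> r; apply: e0.
have [|e2 [e2E e20]] := ladj (z - g e1).
  move=> _ [r [i [Ii ->]]]; rewrite scalerDl -scalerA scalerBr -linearZ e1E eE.
  by rewrite subrr scaler0 add0r scalerBr Iz // -linearZ e10 // linear0 subrr.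
exists (e1 + e2); rewrite linearD e2E addrC subrK; split=> // i Ii.
by rewrite scalerDr e10 // e20 ?addr0 //; apply: sub_adjoin.
Qed.

(** If [R / P] embeds into [R / y R] then [Ext^1(R / y R, V)] surjects onto
    [Ext^1(R / P, V)]; the former vanishes when multiplication by [y] is onto
    on [V], or when [y = 0]. *)
Lemma liftable_embedded (P : R -> Prop) (w y : R) :
  (forall a, P a <-> multiples y (a * w)) ->
  (forall e, (exists v, y *: e = f v) -> exists v, y *: e = y *: f v) ->
  liftable P.
Proof.
move=> Pw div z Pz; have [_ injE injZ gsurj gf] := ses.
have [|z' [z'E z'0]] := injective_element (e := z) injZ (multiples_ideal y) (a := w).
  by move=> r /Pw; apply: Pz.
have [e eE] := gsurj z'.
have [|v vE] := div e.
  apply/gf; rewrite linearZ eE; apply: z'0.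
  by exists 1; rewrite mul1r.
exists (w *: (e - f v)); split.
  by rewrite linearZ linearB eE [g (f v)](gf _).2 ?subr0 //; exists v.
move=> i /Pw[r rE]; rewrite scalerA rE -scalerA scalerBr vE subrr.
exact: scaler0.
Qed.

Hypothesis Vdiv : forall v : V, exists v', v = x *: v'.

(** Noetherian induction: a maximal counterexample is prime by
    [liftable_colon], and primes are covered by [liftable_embedded]. *)
Lemma liftable_all I : is_ideal I -> liftable I.
Proof.
move=> idI; apply: contrapT => nI; have noe := onedim_noetherian RM.
pose F (K : R -> Prop) := is_ideal K /\ ~ liftable K.
have [||P [[idP nP] Pmax]] := @noetherian_max R F noe.
- by move=> K [].
- by exists I.
have bigger K : is_ideal K -> (forall a, P a -> K a) ->
    (exists a, K a /\ ~ P a) -> liftable K.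
  move=> idK PK [a [Ka nPa]]; apply: contrapT => nK; apply: nPa.
  by apply: (Pmax K).
have prP : is_prime P.
  split=> //.
    move=> P1; apply: nP => z Pz; exists 0; rewrite linear0; split=> [|i _].
      by rewrite -[z]scale1r Pz.
    by rewrite scaler0.
  move=> a b Pab; have [|nPa] := EM (P a); [by left|right].
  apply: contrapT => nPb; apply: nP; apply: (liftable_colon (a := a) idP).
    apply: bigger; first exact: colon_ideal.
      by move=> r Pr; apply: idealMr.
    by exists b; rewrite /colon mulrC.
  apply: bigger; first exact: adjoin_ideal.
    by move=> r; apply: sub_adjoin.
  by exists a; split=> //; apply: mem_adjoin.
apply: nP; have [[z zP]|nz] := EM (exists z, M z /\ ~ P z).
  have [y yP] : exists y, forall a, P a <-> a * y = 0.
    by apply: (prime_annihilator RM) => //; exists z.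
  apply: (liftable_embedded (y := 0) (w := y)).
    move=> a; rewrite yP; split=> [->|[r ->]]; last by rewrite mulr0.
    by exists 0; rewrite mul0r.
  by move=> e _; exists 0; rewrite !scale0r.
have PM a : P a <-> M a.
  split; first exact: prime_sub_max.
  by move=> Ma; apply: contrapT => nPa; apply: nz; exists a.
have [w [nw wM]] := socle_mod_regular RM Mx rx.
apply: (liftable_embedded (y := x) (w := w)).
  move=> a; rewrite PM; split=> [|[r rE]]; first exact: wM.
  apply: contrapT => /(onedim_unit RM)[b ab]; apply: nw; exists (b * r).
  by rewrite -mulrA -rE mulrA [b * a]mulrC ab mul1r.
by move=> e [v ->]; have [v' ->] := Vdiv v; exists v'; rewrite linearZ.
Qed.

(** [Ext^1(R / P, V) = 0] for all primes, since [R / P] embeds into [R] or, for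
    the maximal ideal, into [R / x R]. *)
Lemma divisible_kernel_injective : injective_module V.
Proof.
have [injf injE injZ gsurj gf] := ses.
apply: baer => I h idI hlin.
have h0 : h 0 = 0.
  apply: (addrI (h 0)).
  have := hlin 1 0 0 (ideal0 idI) (ideal0 idI).
  by rewrite mulr0 addr0 scale1r addr0 => <-.
have lin : linear (fun i : submod (mk_ideal idI) => f (h (val i))).
  move=> a i j; rewrite -linearP -hlin //.
  - exact/(mk_idealE idI)/(valP i).
  - exact/(mk_idealE idI)/(valP j).
have [e eP] := injective_extend_ideal (mk_linear lin) injE.
have {}eP i : I i -> f (h i) = i *: e.
  by move=> Ii; apply: (eP (Submod ((mk_idealE idI i).2 Ii))).
have [|e' [e'E e'0]] := liftable_all idI (z := g e).
  by move=> i Ii; rewrite -linearZ; apply/gf; exists (h i); rewrite eP.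
have [v vE] : exists v, e - e' = f v by apply/gf; rewrite linearB e'E subrr.
exists v => i Ii; apply: injf; rewrite linearZ /= -vE scalerBr e'0 // subr0.
exact: eP.
Qed.

End Kernel.

Lemma zero_module_injective (R : comNzRingType) (E : lmodType R) :
  (forall e : E, e = 0) -> injective_module E.
Proof.
by move=> E0 U W f g _; exists [the {linear W -> E} of \0%R] => u; rewrite [RHS]E0.
Qed.

Lemma injective_divisible (R : comNzRingType) (E : lmodType R) (x : R) (e : E) :
  injective_module E -> regular x -> exists e', e = x *: e'.
Proof.
move=> injE rx; have id0 := multiples_ideal (0 : R).
have [|e' [<- _]] := injective_element (e := e) injE id0 (a := x).
  move=> r [s]; rewrite mulr0 mulrC => /rx ->; exact: scale0r.
by exists e'.
Qed.

Section Resolution.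
Variables (R : comNzRingType) (M : R -> Prop).
Hypothesis RM : onedim M.
Variables (V : lmodType R) (I : inj_resolution V).

Lemma cycles_closed i : prop_submod_closed (fun e : I i => res_diff I i e = 0).
Proof.
split; first exact: linear0.
by move=> a u v u0 v0; rewrite linearP u0 v0 scaler0 addr0.
Qed.

Definition cycles i : lmodType R := submod (prop_submod (cycles_closed i)).

Lemma diff_cycle i (e : I i) : res_diff I i e \in prop_submod (cycles_closed i.+1).
Proof. by apply/asboolP/res_exact; exists e. Qed.

Lemma to_cycles_linear i :
  linear (fun e : I i => Submod (diff_cycle e) : cycles i.+1).
Proof. by move=> a u v; apply: val_inj; apply: (linearP (res_diff I i)). Qed.

Definition to_cycles i := mk_linear (@to_cycles_linear i).

Lemma to_cycles_surj i (z : cycles i.+1) : exists e, to_cycles i e = z.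
Proof.
have /asboolP/res_exact[e eE] := valP z.
by exists e; apply: val_inj.
Qed.

Lemma to_cycles0 i (e : I i) : to_cycles i e = 0 <-> res_diff I i e = 0.
Proof. by split=> [/(congr1 val)//|e0]; apply: val_inj. Qed.

(** Cosyzygies of positive index are quotients of injective modules, hence
    divisible, so [divisible_kernel_injective] applies from the end of the
    resolution downwards. *)
Lemma cycles_injective n i : (forall j, (n < j)%N -> forall e : I j, e = 0) ->
  injective_module (cycles i.+1).
Proof.
move=> In; have [x [Mx rx]] := onedim_regular RM.
have [k] := ubnP (n - i); elim: k i => // k IH i ik.
have [ni|ni] := ltnP n i.+1.
  apply: zero_module_injective => u; apply: val_inj; exact: In ni (val u).
have ses : injective_ses [the {linear cycles i.+1 -> I i.+1} of val] (to_cycles i.+1).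
  split; [exact: val_inj | exact: res_injective | | exact: to_cycles_surj |].
    by apply: IH; lia.
  move=> e; rewrite to_cycles0; split=> [e0|[v ->]].
    have ve : e \in prop_submod (cycles_closed i.+1) by apply/asboolP.
    by exists (Submod ve).
  exact/asboolP/(valP v).
apply: (divisible_kernel_injective RM Mx rx ses) => v.
have [e <-] := to_cycles_surj v.
have [e' ->] := injective_divisible e (@res_injective _ _ I i) rx.
by exists (to_cycles i e'); rewrite linearZ.
Qed.

(** Finite injective dimension is thus at most one, whichever finite resolution
    is given. *)
Lemma resolution_ses : (exists n, forall j, (n < j)%N -> forall e : I j, e = 0) ->
  injective_ses (res_aug I) (to_cycles 0).
Proof.
move=> [n In]; split.
- exact: res_aug_inj.
- exact: res_injective.
- exact: cycles_injective In.
- exact: to_cycles_surj.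
- by move=> e; rewrite to_cycles0; apply: res_exact0.
Qed.

End Resolution.

(** [Ext^1(R / m, V)] is spanned by the extension class of [e], read in an
    injective module [E] containing [V]: an element [e] with [m e <= V] is the
    same as an extension of [R / m] by [V] up to the socle of [E]. *)
Definition socle_generator (R : comNzRingType) (M : R -> Prop)
    (V E : lmodType R) (f : {linear V -> E}) (e0 : E) : Prop :=
  [/\ forall z, M z -> exists v, z *: e0 = f v,
      ~ exists v, forall z, M z -> z *: e0 = f (z *: v)
    & forall e, (forall z, M z -> exists v, z *: e = f v) ->
        exists c v, forall z, M z -> z *: e = z *: (c *: e0 + f v)].

Section TypeOne.
Variables (R : comNzRingType) (m : ideal R) (V : lmodType R).
Variable (I : inj_resolution V).
Hypothesis Rm : onedim (fun x : R => x \in m).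

Let k : lmodType R := quomod m.
Let one : k := \pi_(quomod m) (1 : R).
Let X : lmodType R := submod (cocycles I k 1).
Let d := res_diff I.
Let f := res_aug I.
Let B := coboundaries I k 1.
Let cls (xi : X) : Ext I k 1 := \pi_(quomod B) xi.

Lemma residue_generated (q : k) : exists r, q = r *: one.
Proof.
elim/quomod_ind: q => r; exists (r : R).
by rewrite -[RHS]/(quomod_scale _ _) quomod_scale_pi -[_ *: _]/(_ * _ : R) mulr1.
Qed.

Lemma residue_pi (z : R) : z \in m -> z *: one = 0.
Proof.
move=> mz; rewrite -[LHS]/(quomod_scale _ _) quomod_scale_pi.
rewrite -(raddf0 (\pi_(quomod m))); apply/quomod_eq.
by rewrite subr0 -[_ *: _]/(_ * _ : R) mulr1.
Qed.

Lemma residue_one_neq0 : one <> 0.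
Proof.
rewrite -(raddf0 (\pi_(quomod m))) => /quomod_eq; rewrite subr0.
exact: onedim_one Rm.
Qed.

Lemma residue_hom (W : lmodType R) (u : W) :
  (forall z : R, z \in m -> z *: u = 0) -> exists h : {linear k -> W}, h one = u.
Proof.
move=> mu; have lin : linear (fun r : R^o => (r : R) *: u).
  by move=> a r s; rewrite scalerDl scalerA.
exists (quomod_lift (g := mk_linear lin) mu).
by rewrite quomod_lift_pi /= scale1r.
Qed.

Lemma cocycle_exists e : (forall z : R, z \in m -> exists v, z *: e = f v) ->
  exists xi : X, val xi one = d 0 e.
Proof.
move=> me; have [|h hE] := @residue_hom _ (d 0 e).
  by move=> z /me[v zv]; rewrite -linearZ; apply/res_exact0; exists v.
have cyc : (h : Hom k (I 1)) \in cocycles I k 1.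
  apply/asboolP => q; have [r ->] := residue_generated q.
  rewrite linearZ hE -linearZ; apply/res_exact; by exists (r *: e).
by exists (Submod cyc).
Qed.

Lemma cocycle_element (xi : X) : exists e, val xi one = d 0 e /\
  forall z : R, z \in m -> exists v, z *: e = f v.
Proof.
have /asboolP/(_ one)/res_exact[e eE] := valP xi.
exists e; split=> // z mz; apply/res_exact0.
by rewrite linearZ -[res_diff I 0 e]eE -linearZ residue_pi ?linear0.
Qed.

(** The class of [e] vanishes when [e] is the sum of an element of [V] and of
    a socle element of [I 0]. *)
Lemma coboundaryP (xi : X) e : val xi one = d 0 e ->
  cls xi = 0 <->
  (exists v, forall z : R, z \in m -> z *: e = f (z *: v)).
Proof.
move=> xiE; rewrite /cls -(raddf0 (\pi_(quomod B))).
split=> [/quomod_eq|[v vE]].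
  rewrite subr0 => /asboolP[g gE].
  have [v vE] : exists v, e - g one = f v.
    by apply/res_exact0; rewrite linearB -gE -/d -xiE subrr.
  exists v => z mz; rewrite linearZ /= -vE scalerBr -[z *: g one]linearZ.
  by rewrite residue_pi // linear0 subr0.
apply/quomod_eq; rewrite subr0; apply/asboolP.
have [|g gE] := @residue_hom _ (e - f v).
  by move=> z mz; rewrite scalerBr vE // linearZ subrr.
exists g => q; have [r ->] := residue_generated q.
have dfv : res_diff I 0 (f v) = 0 by apply/res_exact0; exists v.
by rewrite !linearZ gE linearB dfv subr0 -/d -xiE.
Qed.

Lemma ext1_pi (p : Ext I k 1) : exists xi : X, p = cls xi.
Proof. by exists (repr p); rewrite /cls reprK. Qed.

Lemma ext1_scale (xi : X) (c : R) : c *: cls xi = cls (c *: xi).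
Proof. exact: quomod_scale_pi. Qed.

Lemma ext1_sub (xi xi0 : X) (c : R) :
  cls xi = c *: cls xi0 <-> cls (xi - c *: xi0) = 0.
Proof.
rewrite ext1_scale /cls -[0 in X in _ <-> X](raddf0 (\pi_(quomod B))).
split=> [/quomod_eq H|/quomod_eq]; last by rewrite subr0 => /quomod_eq.
by apply/quomod_eq; rewrite subr0.
Qed.

Lemma socle_generator_of_ext1 :
  isomorphic (Ext I k 1) {ffun 'I_1 -> k} ->
  exists e0, socle_generator (fun x : R => x \in m) f e0.
Proof.
case=> h [g hK gK]; pose eps := g [ffun=> one].
have [xi0 xi0E] := ext1_pi eps; have [e0 [e0E me0]] := cocycle_element xi0.
exists e0; split=> // [nv|e me].
  have eps0 : eps = 0 by rewrite xi0E; apply/(coboundaryP e0E).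
  have := gK [ffun=> one]; rewrite -/eps eps0 linear0.
  by move=> /ffunP/(_ ord0); rewrite !ffunE => /esym/residue_one_neq0.
have [xi xiE] := cocycle_exists me.
have [c cE] := residue_generated (h (cls xi) ord0).
have /ext1_sub xi0c : cls xi =
    c *: cls xi0.
  apply: (can_inj hK); rewrite linearZ -xi0E gK; apply/ffunP => i.
  by rewrite !ffunE ord1 cE.
have [|v vE] := (@coboundaryP (xi - c *: xi0) (e - c *: e0) _).1 xi0c.
  have -> : d 0 (e - c *: e0) = d 0 e - c *: d 0 e0 by rewrite linearB linearZ.
  by rewrite -xiE -e0E.
exists c, v => z mz; rewrite scalerDr -[z *: f v]linearZ -vE // scalerBr addrC.
by rewrite subrK.
Qed.

Lemma ext1_of_socle_generator e0 :
  socle_generator (fun x : R => x \in m) f e0 ->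
  isomorphic (Ext I k 1) {ffun 'I_1 -> k}.
Proof.
move=> [me0 ne0 ge0]; have [xi0 xi0E] := cocycle_exists me0.
pose eps : Ext I k 1 := cls xi0.
have epsE (r : R) : r *: eps = 0 <->
    exists v, forall z : R, z \in m -> z *: (r *: e0) = f (z *: v).
  rewrite ext1_scale.
  apply: coboundaryP.
  have -> : d 0 (r *: e0) = r *: d 0 e0 by rewrite linearZ.
  by rewrite -xi0E.
have [z mz|psi psi1] := @residue_hom _ eps.
  apply/epsE; have [v vE] := me0 z mz; exists v => z' _.
  by rewrite vE linearZ.
have psiE (r : R) : psi (r *: one) = r *: eps by rewrite linearZ psi1.
have [||phi phiK psiK] := @bijective_of_inj_surj _ _ _ psi.
- suff ker q : psi q = 0 -> q = 0.
    by move=> p q pq; apply/eqP; rewrite -subr_eq0 -(ker (p - q)) // linearB pq subrr.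
  have [r ->] := residue_generated q; rewrite psiE => /epsE[v vE].
  have [|nr] := boolP (r \in m); first exact: residue_pi.
  have [s rs] := onedim_unit Rm (negP nr); case: ne0; exists (s *: v) => z mz.
  rewrite scalerA -vE; last by apply: (idealMr s (mem_is_ideal m)).
  by rewrite scalerA -mulrA [s * r]mulrC rs mulr1.
- move=> p; have [xi ->] := ext1_pi p.
  have [e [eE me]] := cocycle_element xi; have [c [v cv]] := ge0 e me.
  exists (c *: one); rewrite psiE; apply/esym/ext1_sub.
  apply/(@coboundaryP _ (e - c *: e0)).
    have -> : d 0 (e - c *: e0) = d 0 e - c *: d 0 e0 by rewrite linearB linearZ.
    by rewrite -eE -xi0E.
  by exists v => z mz; rewrite scalerBr cv // scalerDr addrC addKr linearZ.
have linphi : linear phi by apply: can2_linear phiK psiK.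
have lin : linear (fun p : Ext I k 1 => [ffun _ : 'I_1 => phi p]).
  by move=> a p q; apply/ffunP => i; rewrite !ffunE linphi.
exists (mk_linear lin).
exists (fun t : {ffun 'I_1 -> k} => psi (t ord0)).
  by move=> p; rewrite /= ffunE psiK.
by move=> t; apply/ffunP => i; rewrite /= ffunE phiK [i]ord1.
Qed.

End TypeOne.

(** Injective modules containing [V] map to each other over [V]. *)
Lemma socle_generator_transfer (R : comNzRingType) (M : R -> Prop)
    (V E E' : lmodType R) (f : {linear V -> E}) (f' : {linear V -> E'}) :
  injective f -> injective f' -> injective_module E -> injective_module E' ->
  (exists e0, socle_generator M f e0) -> exists e0', socle_generator M f' e0'.
Proof.
move=> injf injf' injE injE' [e0 [me0 ne0 ge0]].
have [h hf] := injE' _ _ f f' injf; have [h' hf'] := injE _ _ f' f injf'.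
exists (h e0); split.
- by move=> z /me0[v vE]; exists v; rewrite -linearZ vE hf.
- move=> [v vE]; apply: ne0; exists v => z Mz; have [w wE] := me0 z Mz.
  rewrite wE; congr (f _); apply: injf'.
  by rewrite -vE // -linearZ wE hf.
- move=> e me; have [|c [v cv]] := ge0 (h' e).
    by move=> z /me[v vE]; exists v; rewrite -linearZ vE hf'.
  exists c, v => z Mz; have [w wE] := me z Mz; have [u uE] := me0 z Mz.
  have wu : w = c *: u + z *: v.
    apply: injf; rewrite -hf' -wE linearZ /= cv // scalerDr linearD !linearZ /=.
    by rewrite -uE !scalerA mulrC.
  rewrite wE wu linearD scalerDr !linearZ /= -hf -uE linearZ.
  by rewrite /= !scalerA mulrC.
Qed.

(** The form in which canonical ideals are used: [K] embeds into the injective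
    module [E] through multiplication by [e1], with injective cokernel, and [e0]
    generates the extensions of the residue field by [K]. *)
Record canonical_embedding (R : comNzRingType) (M K : R -> Prop)
    (E Z : lmodType R) (g : {linear E -> Z}) (e1 e0 : E) : Prop := {
  cembE : injective_module E;
  cembZ : injective_module Z;
  cemb_surj : forall z, exists e, g e = z;
  cemb_exact : forall e, g e = 0 <-> exists k, K k /\ e = k *: e1;
  cemb_inj : forall k, K k -> k *: e1 = 0 -> k = 0;
  cemb_soc : forall z, M z -> exists k, K k /\ z *: e0 = k *: e1;
  cemb_soc_neq0 : ~ exists k, K k /\ forall z, M z -> z *: e0 = (z * k) *: e1;
  cemb_soc_gen : forall e, (forall z, M z -> exists k, K k /\ z *: e = k *: e1) ->
    exists c k, K k /\ forall z, M z -> z *: e = z *: (c *: e0 + k *: e1) }.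

Definition canonically_embedded (R : comNzRingType) (M K : R -> Prop) : Prop :=
  exists E Z g e1 e0, @canonical_embedding R M K E Z g e1 e0.

Lemma krull_dim_unique (R : comNzRingType) d d' :
  krull_dim R d -> krull_dim R d' -> d = d'.
Proof.
move=> [cd dmax] [cd' dmax']; apply/eqP; rewrite eqn_leq.
by rewrite dmax' // dmax.
Qed.

(** [E] and [Z] come from a finite resolution; the element [e0] is transported
    from the resolution that computes the type, and [e1] is the image of [1]
    when the embedding of the ideal is extended to [R]. *)
Lemma canonical_ideal_embedding (R : comNzRingType) (m D : ideal R) :
  cohen_macaulay m 1 -> canonical_ideal m D ->
  canonically_embedded (fun x : R => x \in m) (fun x : R => x \in D).
Proof.
move=> cm [C [[_ [d [dimd depd]] [t [I [dept ext1]]] [J [n Jn]]] [h bijh]]].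
have Rm := cohen_macaulay_onedim cm; have [_ _ dim1 _] := cm.
have injh := bij_inj bijh.
have t1 : t = 1%N.
  by rewrite (depth_unique dept depd) (krull_dim_unique dimd dim1).
move: ext1; rewrite t1 => /(socle_generator_of_ext1 Rm) gI.
have sesJ := @resolution_ses _ _ Rm _ J (ex_intro _ n Jn).
have [|e0 [me0 ne0 ge0]] := @socle_generator_transfer _ _ _ _ _ _ (res_aug J)
    (@res_aug_inj _ _ I) (@res_aug_inj _ _ J) _ (@res_injective _ _ J 0) gI.
  exact: res_injective.
have [injf injE injZ gsurj gf] := sesJ.
pose f : {linear submod D -> J 0} := [the {linear submod D -> J 0} of res_aug J \o h].
have [e1 fE] := injective_extend_ideal f injE.
have augE v : exists k : R, k \in D /\ forall a : R, a *: res_aug J v = (a * k) *: e1.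
  have [h' hK h'K] := bijh; exists (val (h' v)); split; first exact: (valP (h' v)).
  by move=> a; rewrite -scalerA -fE /= h'K.
have augE' (k : R) : k \in D ->
    exists v, forall a : R, (a * k) *: e1 = res_aug J (a *: v).
  move=> Dk; exists (h (Submod Dk)) => a.
  by rewrite -scalerA -[k]/(val (Submod Dk)) -fE linearZ.
exists (J 0), (cycles J 1), (to_cycles J 0), e1, e0; split=> //.
- move=> e; rewrite gf; split=> [[v ->]|[k [Dk ->]]].
    have [k [Dk kE]] := augE v; exists k; split=> //.
    by have := kE 1; rewrite scale1r mul1r.
  by have [v vE] := augE' k Dk; exists v; have := vE 1; rewrite mul1r scale1r.
- move=> k Dk k0; have : f (Submod Dk) = 0 by rewrite fE.
  rewrite /= -(linear0 (res_aug J)) => /injf; rewrite -(linear0 h) => /injh.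
  by move/(congr1 val).
- move=> z /me0[v vE]; have [k [Dk kE]] := augE v; exists k; split=> //.
  by have := kE 1; rewrite scale1r mul1r vE.
- move=> [k [Dk kE]]; apply: ne0; have [v vE] := augE' k Dk; exists v => z mz.
  by rewrite kE.
- move=> e me; have [|c [v cv]] := ge0 e.
    move=> z /me[k [Dk ->]]; have [v vE] := augE' k Dk; exists v.
    by have := vE 1; rewrite mul1r scale1r.
  have [k [Dk kE]] := augE v; exists c, k; split=> // z mz.
  by rewrite cv // !scalerDr kE scalerA.
Qed.

Section CanonicalIdeal.
Variables (R : comNzRingType) (M K : R -> Prop).
Hypotheses (RM : onedim M) (idK : is_ideal K) (canK : canonically_embedded M K).
Implicit Types (I : R -> Prop).

(** The duality [K : (K : I) = I], with the fractions cleared: [p / i0] runs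
    over [K : I]. If it failed, it would fail for some [y] in the socle modulo
    [I]. As [E / K] is injective, the map [I + R y -> E / K] killing [I] and
    sending [y] to the class of [e0] is multiplication by the class of some
    [e]. Then [i0 e = p e1] with [p / i0] in [K : I], and the hypothesis on [y]
    makes the extension class of [e0] split. *)
Lemma canonical_duality I i0 y : is_ideal I -> I i0 -> regular i0 ->
  (forall p, K p -> (forall i, I i -> exists k, K k /\ p * i = i0 * k) ->
     exists k, K k /\ p * y = i0 * k) ->
  I y.
Proof.
move=> idI Ii0 ri0 yI; apply: contrapT => nIy.
have [r [nIry ryM]] := socle_above RM idI (regular_faithful Ii0 ri0) nIy.
have {}yI p : K p -> (forall i, I i -> exists k, K k /\ p * i = i0 * k) ->
     exists k, K k /\ p * (r * y) = i0 * k.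
  move=> Kp /(yI p Kp)[k [Kk kE]]; exists (r * k); split; first exact: idealM.
  by rewrite mulrCA kE mulrCA.
move: (r * y) nIry ryM yI => {}y {}nIy yM yI {r}.
have [E [Z [g [e1 [e0 [injE injZ gsurj gf inj1 soc nsoc _]]]]]] := canK.
have [|z' [z'E z'0]] := injective_element (e := g e0) (a := y) injZ idI.
  move=> r Iry; rewrite -linearZ; apply/gf/soc; apply: contrapT => nMr.
  have [s rs] := onedim_unit RM nMr; apply: nIy.
  by rewrite -[y]mul1r -rs [r * s]mulrC -mulrA; apply: idealM.
have [e eE] := gsurj z'.
have Ie i : I i -> exists k, K k /\ i *: e = k *: e1.
  by move=> Ii; apply/gf; rewrite linearZ eE; apply: z'0.
have [p [Kp pE]] := Ie _ Ii0.
have [|k [Kk kE]] := yI p Kp.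
  move=> i Ii; have [k [Kk kE]] := Ie i Ii; exists k; split=> //.
  apply/eqP; rewrite -subr_eq0; apply/eqP/inj1.
    by apply: idealB => //; [apply: idealMr | apply: idealM].
  by rewrite scalerBl mulrC -!scalerA -pE -kE !scalerA mulrC subrr.
have [k0 [Kk0 k0E]] : exists k0, K k0 /\ y *: e - e0 = k0 *: e1.
  by apply/gf; rewrite linearB linearZ eE /= z'E subrr.
have i0e0 : i0 *: e0 = (i0 * (k - k0)) *: e1.
  have -> : e0 = y *: e - k0 *: e1 by rewrite -k0E opprB addrC subrK.
  rewrite scalerBr !scalerA [i0 * y]mulrC -[(y * i0) *: e]scalerA pE scalerA.
  rewrite [y * p]mulrC kE mulrBr.
  by rewrite scalerBl.
have Kkk : K (k - k0) by apply: idealB.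
apply: nsoc; exists (k - k0); split=> // z Mz; have [kz [Kkz kzE]] := soc z Mz.
rewrite kzE; congr (_ *: _); apply: (regular_inj ri0).
apply/eqP; rewrite -subr_eq0; apply/eqP/inj1.
  by apply: idealB => //; apply: idealM => //; apply: idealM.
rewrite scalerBl -scalerA -kzE scalerA mulrC -scalerA i0e0 scalerA.
by rewrite mulrCA subrr.
Qed.

(** Duality for [I = x R], where [K : I] is [K / x], gives [K : K = R]. *)
Lemma canonical_endomorphism x y : regular x ->
  (forall k, K k -> exists k', K k' /\ y * k = x * k') -> multiples x y.
Proof.
move=> rx yK; apply: (canonical_duality (multiples_ideal x) _ rx).
  by exists 1; rewrite mul1r.
by move=> p Kp _; have [k [Kk kE]] := yK p Kp; exists k; rewrite mulrC.
Qed.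

(** If [y K = 0] then [y = x y'] because [K : K = R], and again [y' K = 0]. *)
Lemma canonical_faithful : faithful K.
Proof.
have [x [Mx rx]] := onedim_regular RM.
pose ann y := forall k, K k -> y * k = 0.
move=> y yK; apply: (divisible_ideal0 RM (I := ann) Mx) => //.
move=> {yK}y yK; have [|y' yE] := @canonical_endomorphism x y rx.
  by move=> k Kk; exists 0; rewrite yK // mulr0; split=> //; apply: ideal0.
exists y'; split; last by rewrite mulrC.
by move=> k Kk; apply: rx; rewrite mulrA [x * _]mulrC -yE yK.
Qed.

Lemma canonical_regular : exists d, K d /\ regular d.
Proof. exact (faithful_regular RM idK canonical_faithful). Qed.

End CanonicalIdeal.

(** With [L = D2 : D1] and [L' = D1 : D2], duality turns [L L' <= m] into [(R : m) D2 <= D2],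
    contradicting [D2 : D2 = R]; so some product of elements of [L] and [L']
    is a unit. *)
Lemma canonical_ideal_unique (R : comNzRingType) (M D1 D2 : R -> Prop) :
  onedim M -> is_ideal D1 -> is_ideal D2 ->
  canonically_embedded M D1 -> canonically_embedded M D2 ->
  exists p q, [/\ regular p, regular q,
    forall d, D1 d -> exists d', D2 d' /\ p * d = q * d' &
    forall d', D2 d' -> exists d, D1 d /\ p * d = q * d'].
Proof.
move=> RM id1 id2 can1 can2.
have [d1 [D1d1 rd1]] := canonical_regular RM id1 can1.
have [d2 [D2d2 rd2]] := canonical_regular RM id2 can2.
pose L p := forall d, D1 d -> exists d', D2 d' /\ p * d = d1 * d'.
pose L' p := forall d, D2 d -> exists d', D1 d' /\ p * d = d2 * d'.
have LL' p p' : L p -> L' p' -> exists r, p * p' = r * (d1 * d2).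
  move=> Lp Lp'; apply: (canonical_endomorphism RM id2 can2 (regularM rd1 rd2)).
  move=> k /Lp'[k' [Dk' kE]]; have [k'' [Dk'' kE']] := Lp k' Dk'.
  exists k''; split=> //.
  by rewrite -mulrA kE mulrCA kE' mulrA [d2 * d1]mulrC.
have [[p [p' [u [v [Lp Lp' uv pp']]]]]|nu] :=
    EM (exists p p' u v, [/\ L p, L' p', u * v = 1 & p * p' = u * (d1 * d2)]).
  have rp : regular p.
    move=> y py0; apply: (regularM rd1 rd2).
    have : u * (d1 * d2 * y) = 0 by rewrite mulrA -pp' mulrAC py0 mul0r.
    by move/(congr1 ( *%R v)); rewrite mulr0 mulrA [v * u]mulrC uv mul1r.
  exists p, d1; split=> // d' Dd'; have [d [Dd dE]] := Lp' d' Dd'.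
  exists (v * d); split; first exact: idealM.
  have dE2 : d2 * (p * d) = u * (d1 * d2) * d'.
    by rewrite mulrCA -dE [p * _]mulrA pp'.
  apply: (regular_inj rd2).
  have -> : d2 * (p * (v * d)) = v * (d2 * (p * d)) by ring.
  rewrite dE2; have -> : v * (u * (d1 * d2) * d') = u * v * (d2 * (d1 * d')) by ring.
  by rewrite uv mul1r.
have [x [Mx rx]] := onedim_regular RM.
have [w [nw wM]] := socle_mod_regular RM Mx rx.
case: nw; apply: (canonical_endomorphism RM id2 can2 rx) => d Dd.
have wpp p p' : L p -> L' p' -> exists r, w * (p * p') = r * (x * (d1 * d2)).
  move=> Lp Lp'; have [r rE] := LL' p p' Lp Lp'; have [/wM[s sE]|] := EM (M r).
    by exists s; rewrite rE mulrA [w * r]mulrC sE -mulrA.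
  by move/(onedim_unit RM) => [v rv]; case: nu; exists p, p', r, v.
have dvd_xd2 : exists k, D2 k /\ w * d = x * k.
  have rx2 : regular (x * d2) by apply: regularM.
  have idxD2 : is_ideal (fun y => exists k, D2 k /\ y = x * k).
    split; first by exists 0; rewrite mulr0; split=> //; apply: ideal0.
    move=> a _ _ [k [Dk ->]] [k' [Dk' ->]]; exists (a * k + k').
    by split; [apply: (id2.2) | ring].
  apply: (canonical_duality RM id1 can1 idxD2 _ rx2 (y := w * d)).
    by exists d2.
  move=> p' Dp' p'E; have Lp' : L' p'.
    move=> k Dk; have [|k' [Dk' k'E]] := p'E (x * k); first by exists k.
    exists k'; split=> //; apply: (regular_inj rx).
    by rewrite mulrCA k'E mulrA.
  have idI : is_ideal (fun y => exists k, D1 k /\ y = x * d2 * k).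
    split; first by exists 0; rewrite mulr0; split=> //; apply: ideal0.
    move=> a _ _ [k [Dk ->]] [k' [Dk' ->]]; exists (a * k + k').
    by split; [apply: (id1.2) | ring].
  apply: (canonical_duality RM id2 can2 idI _ (regularM rx2 rd1)).
    by exists d1.
  move=> p Dp pE; have Lp : L p.
    move=> k Dk; have [|k' [Dk' k'E]] := pE (x * d2 * k); first by exists k.
    exists k'; split=> //; apply: (regular_inj rx2).
    by rewrite mulrCA k'E mulrA.
  have [r rE] := wpp p p' Lp Lp'; exists (r * d); split; first exact: idealM.
  have -> : p * (p' * (w * d)) = w * (p * p') * d by ring.
  by rewrite rE; ring.
exact: dvd_xd2.
Qed.

Lemma ideal_isomorphism (R : comNzRingType) (D1 D2 : ideal R) (p q : R) :
  regular p -> regular q ->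
  (forall d : R, d \in D1 -> exists d', d' \in D2 /\ p * d = q * d') ->
  (forall d' : R, d' \in D2 -> exists d, d \in D1 /\ p * d = q * d') ->
  isomorphic (submod D1) (submod D2).
Proof.
move=> rp rq D12 D21.
have /choice[f fP] (d : submod D1) : exists d' : submod D2, p * val d = q * val d'.
  by have [d' [Dd' dE]] := D12 _ (valP d); exists (Submod Dd').
have lin : linear f.
  move=> a u v; apply: val_inj; apply: (regular_inj rq); rewrite -fP.
  change (p * (a * val u + val v) = q * (a * val (f u) + val (f v))).
  by rewrite !mulrDr mulrCA !fP; congr (_ + _); rewrite mulrCA.
exists (mk_linear lin); apply: bijective_of_inj_surj => [u v uv|d'].
  have {}uv : f u = f v by [].
  by apply: val_inj; apply: (regular_inj rp); rewrite !fP uv.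
have [d [Dd dE]] := D21 _ (valP d'); exists (Submod Dd).
by apply: val_inj; apply: (regular_inj rq); rewrite -fP -dE.
Qed.

(** * Biduals of ideals and their length *)

(** For a nonzerodivisor [d] in [I], this is [R : I] multiplied by [d]. *)
Definition dual_ideal (R : comNzRingType) (d : R) (I : R -> Prop) : R -> Prop :=
  fun a => forall i, I i -> multiples d (a * i).

Section DualIdeal.
Variables (R : comNzRingType) (d : R).
Implicit Types I J : R -> Prop.

Lemma dual_ideal_ideal I : is_ideal (dual_ideal d I).
Proof.
split=> [i _|a x y Ix Iy i Ii]; first by exists 0; rewrite !mul0r.
by rewrite mulrDl -mulrA; apply: (multiples_ideal d).2; [apply: Ix | apply: Iy].
Qed.

Lemma dual_idealS I J : (forall x, I x -> J x) ->
  forall x, dual_ideal d J x -> dual_ideal d I x.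
Proof. by move=> IJ x Jx i /IJ/Jx. Qed.

Lemma sub_bidual I x : I x -> dual_ideal d (dual_ideal d I) x.
Proof. by move=> Ix a /(_ x Ix); rewrite mulrC. Qed.

Lemma dual_ideal_mem I : dual_ideal d I d.
Proof. by move=> i _; exists i; rewrite mulrC. Qed.

End DualIdeal.

(** [J / I] is isomorphic to the residue field, the class of [y] being a
    generator. *)
Definition simple_step (R : comNzRingType) (M I J : R -> Prop) : Prop :=
  [/\ is_ideal I, is_ideal J, forall x, I x -> J x &
   exists y, [/\ J y, ~ I y, forall z, M z -> I (z * y) &
     forall x, J x -> exists c i, I i /\ x = c * y + i]].

Inductive ideal_series (R : comNzRingType) (M : R -> Prop) :
    (R -> Prop) -> (R -> Prop) -> nat -> Prop :=
| series_nil I : is_ideal I -> ideal_series M I I 0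
| series_cons I I' J n : simple_step M I I' -> ideal_series M I' J n ->
    ideal_series M I J n.+1.

Section Series.
Variables (R : comNzRingType) (M : R -> Prop).
Implicit Types I J : R -> Prop.

Lemma pred_ext I J : (forall x, I x <-> J x) -> I = J.
Proof. by move=> IJ; apply/funext => x; apply/propext. Qed.

Lemma series_sub I J n : ideal_series M I J n -> forall x, I x -> J x.
Proof. by elim=> // {}I I' {}J {}n [_ _ II' _] _ IH x /II'/IH. Qed.

Lemma series_cat I J K n k :
  ideal_series M I J n -> ideal_series M J K k -> ideal_series M I K (n + k).
Proof.
by elim=> // {}I I' {}J {}n st _ IH /IH; apply: series_cons.
Qed.

(** Modulo a faithful ideal the ring is of finite length: add socle elements
    one at a time. *)
Lemma series_exists (K J : R -> Prop) : onedim M -> is_ideal K -> is_ideal J ->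
  faithful K -> (forall x, K x -> J x) -> exists n, ideal_series M K J n.
Proof.
move=> RM idK idJ fK KJ; apply: contrapT => nK.
pose F (I : R -> Prop) := [/\ is_ideal I, forall x, K x -> I x,
  forall x, I x -> J x & ~ exists n, ideal_series M I J n].
have [||I [[idI KI IJ nI] Imax]] := @noetherian_max R F (onedim_noetherian RM).
- by move=> I [].
- by exists K.
have [y0 [Jy0 nIy0]] : exists y, J y /\ ~ I y.
  apply: contrapT => nJ; apply: nI; exists 0%N.
  have -> : J = I; last exact: series_nil.
  apply: pred_ext => x; split=> [Jx|/IJ//]; apply: contrapT => nIx.
  by apply: nJ; exists x.
have fI : faithful I by move=> y yI; apply: fK => i /KI/yI.
have [r [nIy yM]] := socle_above RM idI fI nIy0.
have [Jy idI'] := (idealM r idJ Jy0, adjoin_ideal (r * y0) idI).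
have st : simple_step M I (adjoin I (r * y0)).
  split=> //; first by move=> x; apply: sub_adjoin.
  exists (r * y0); split; [exact: mem_adjoin | exact: nIy | exact: yM |].
  by move=> _ [c [i [Ii ->]]]; exists c, i.
have [n nS] : exists n, ideal_series M (adjoin I (r * y0)) J n.
  apply: contrapT => nn; apply: nIy; apply: (Imax (adjoin I (r * y0))).
  - split=> //; first by move=> x /KI; apply: sub_adjoin.
    by move=> _ [c [i [/IJ Ji ->]]]; apply: (idJ.2).
  - by move=> x; apply: sub_adjoin.
  - exact: mem_adjoin.
by apply: nI; exists n.+1; apply: series_cons st nS.
Qed.

Lemma series_chain I J n : ideal_series M I J n ->
  exists S : nat -> R -> Prop, [/\ forall i, is_ideal (S i), S 0%N = I,
    forall i, (n <= i)%N -> S i = J &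
    forall i, (i < n)%N -> simple_step M (S i) (S i.+1)].
Proof.
elim=> [{}I idI|{}I I' {}J {}n st _ [S [idS S0 Sn Sst]]].
  by exists (fun=> I).
exists (fun i => if i is i'.+1 then S i' else I); split=> //.
- by case=> [|i]; [case: st | apply: idS].
- by case=> // i; apply: Sn.
- by case=> [|i] //=; rewrite ?S0 //; apply: Sst.
Qed.

End Series.

(** Each ideal [S i] of the series gives the submodule of classes of those [v]
    with [f v] in [S i]. *)
Lemma series_has_length (R : comNzRingType) (M I J : R -> Prop) (n : nat)
    (V : lmodType R) (V0 : submodClosed V) (f : {linear V -> R^o}) :
  onedim M -> injective f -> (forall x : R, J x <-> exists v, x = f v) ->
  (forall v, v \in V0 <-> I (f v : R)) -> ideal_series M I J n ->
  has_length (quomod V0) n.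
Proof.
move=> RM injf Jf V0I /series_chain[S [idS S0 Sn Sst]].
pose T i (q : quomod V0) := exists v, q = \pi_(quomod V0) v /\ S i (f v : R).
have T_closed i : prop_submod_closed (T i).
  split.
    exists 0; rewrite linear0; split; last exact: (ideal0 (idS i)).
    by rewrite raddf0.
  move=> a _ _ [u [-> Su]] [v [-> Sv]]; exists (a *: u + v).
  split; last by rewrite linearP; apply: (idS i).2.
  rewrite quomod_piD; congr (_ + _); exact: (quomod_scale_pi V0 a u).
have SI i x : (i <= n)%N -> I x -> S i x.
  elim: i => [|i IH] ln; first by rewrite S0.
  by move=> /(IH (ltnW ln)); have [_ _ + _] := Sst i ln; apply.
have Tpi i v : (i <= n)%N -> T i (\pi_(quomod V0) v) <-> S i (f v : R).
  move=> ln; split=> [[u [/quomod_eq/V0I uv Su]]|Sv]; last by exists v.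
  rewrite -(subrK (f u) (f v)) -linearB.
  by apply: (idealD (idS i)) => //; apply: SI.
exists (fun i => prop_submod (T_closed i)); split.
- move=> q /asboolP[v [-> Sv]]; rewrite -(raddf0 (\pi_(quomod V0))).
  by apply/quomod_eq; rewrite subr0; apply/V0I; rewrite -S0.
- elim/quomod_ind => v; apply/asboolP/Tpi => //; rewrite Sn //.
  by apply/Jf; exists v.
move=> i ln; have [_ _ sub [y [Sy nSy yM yS]]] := Sst i ln.
have [v yv] : exists v, y = f v.
  apply/Jf; rewrite -(Sn n) //.
  have up j : (i.+1 + j <= n)%N -> S (i.+1 + j)%N y.
    elim: j => [|j IH]; rewrite ?addn0 // addnS => lj.
    by have [_ _ + _] := Sst _ lj; apply; apply/IH/ltnW.
  by have := up (n - i.+1)%N; rewrite subnKC // leqnn; apply.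
split.
- by move=> q /asboolP[u [-> Su]]; apply/asboolP; exists u; split; last exact: sub.
- move=> /(_ (\pi_(quomod V0) v)) e; apply: nSy.
  rewrite yv; apply/(Tpi i v (ltnW ln)).
  have : \pi_(quomod V0) v \in prop_submod (T_closed i.+1).
    by apply/asboolP/Tpi => //; rewrite -yv.
  by rewrite -e => /asboolP.
move=> P TP PT; have [vP|nvP] := EM (\pi_(quomod V0) v \in P); [right|left].
  move=> q; apply/idP/idP => [/PT//|/asboolP[u [-> Su]]].
  have [c [s [Ss us]]] := yS _ Su.
  have [w sw] : exists w, s = f w.
    exists (u - c *: v); rewrite linearB linearZ /= us yv.
    by rewrite addrC addKr.
  have -> : u = c *: v + w.
    by apply: injf; rewrite linearD linearZ /= -yv -sw.
  rewrite quomod_piD -(quomod_scale_pi V0 c v); apply: rpredD.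
    by rewrite -[quomod_scale _ _]/(c *: (\pi_(quomod V0) v : quomod V0)); apply: rpredZ.
  by apply: TP; apply/asboolP; exists w; rewrite -sw.
move=> q; apply/idP/idP => [Pq|/TP//].
have /asboolP[u [qu Su]] := PT _ Pq; rewrite qu in Pq *.
have [c [s [Ss us]]] := yS _ Su.
have [w sw] : exists w, s = f w.
  exists (u - c *: v); rewrite linearB linearZ /= us yv.
  by rewrite addrC addKr.
have uE : u = c *: v + w by apply: injf; rewrite linearD linearZ /= -yv -sw.
have [Mc|/(onedim_unit RM)[b cb]] := EM (M c).
  apply/asboolP/Tpi; first exact: ltnW.
  by rewrite us; apply: (idealD (idS i)) => //; apply: yM.
case: nvP; have -> : v = b *: (u - w).
  by rewrite uE addrK scalerA mulrC cb scale1r.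
have Pw : (\pi_(quomod V0) w : quomod V0) \in P.
  by apply: TP; apply/asboolP; exists w; rewrite -sw.
have -> : b *: (u - w) = b *: (-1 *: w + u) by rewrite scaleN1r addrC.
rewrite -(quomod_scale_pi V0 b) quomod_piD -(quomod_scale_pi V0 (-1)).
rewrite -[quomod_scale _ _]/(b *: (-1 *: (\pi_(quomod V0) w : quomod V0) +
  \pi_(quomod V0) u)).
by apply: rpredZ; apply: rpredD => //; apply: rpredZ.
Qed.

(** The bidual of [V] is the bidual ideal of its image [K] in [R], by
    evaluation at the embedding itself. *)
Section BidualLength.
Variables (R : comNzRingType) (M : R -> Prop) (V : lmodType R).
Variables (f : {linear V -> R^o}) (v0 : V).
Hypotheses (RM : onedim M) (injf : injective f) (rf : regular (f v0 : R)).

Let d : R := f v0.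
Let K : R -> Prop := fun x => exists v, x = f v.

Lemma bidual_embed_linear : linear (fun Phi : dual (dual V) => Phi (f : dual V) : R^o).
Proof. by []. Qed.

Let theta := mk_linear bidual_embed_linear.

Lemma dual_scale (g : dual V) (v : V) : (g v0 : R) * f v = d * g v.
Proof.
have e : f v *: v0 = d *: v.
  by apply: injf; rewrite !linearZ; exact: mulrC.
transitivity (g (f v *: v0) : R); first by rewrite linearZ; exact: mulrC.
by rewrite e linearZ.
Qed.

Lemma bidual_embed_inj : injective theta.
Proof.
move=> Phi Psi e; apply: Hom_ext => g; apply: (regular_inj rf).
have gE : d *: g = (g v0 : R) *: (f : dual V).
  by apply: Hom_ext => v; apply/esym/dual_scale.
have dE (Xi : dual (dual V)) : d * Xi g = (g v0 : R) * theta Xi.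
  transitivity (Xi (d *: g) : R); first by rewrite linearZ.
  by rewrite gE linearZ.
by rewrite -/d !dE e.
Qed.

Lemma bidual_embed_image x :
  dual_ideal d (dual_ideal d K) x <-> exists Phi, x = theta Phi.
Proof.
split=> [Jx|[Phi ->] a Ka].
  have /choice[h hP] (g : dual V) : exists r : R, x * g v0 = r * d.
    by apply: Jx => _ [v ->]; exists (g v); rewrite dual_scale mulrC.
  have lin : linear (h : dual V -> R^o).
    move=> a g g'; apply: (regular_inj rf); rewrite mulrC -hP.
    transitivity (x * (a * g v0 + g' v0)); first by [].
    by rewrite mulrDr mulrCA !hP -/d -[a *: _]/(a * h g); ring.
  exists (mk_linear lin); apply: (regular_inj rf).
  by rewrite -/d mulrC [LHS](hP (f : dual V)) mulrC.
have /choice[g gP] (v : V) : exists r : R, a * f v = r * d by apply: Ka; exists v.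
have lin : linear (g : V -> R^o).
  move=> c u v; apply: (regular_inj rf); rewrite -/d mulrC -gP.
  by rewrite linearP -[c *: f u]/(c * f u) mulrDr mulrCA !gP -[c *: _]/(c * g u); ring.
exists (Phi (mk_linear lin : dual V)).
have aE : a *: (f : dual V) = d *: (mk_linear lin : dual V).
  by apply: Hom_ext => v; rewrite /= -[LHS]/(a * f v) gP mulrC.
transitivity (Phi (a *: (f : dual V)) : R); first by rewrite linearZ; exact: mulrC.
by rewrite aE linearZ; exact: mulrC.

Qed.

Lemma bidual_length n : ideal_series M K (dual_ideal d (dual_ideal d K)) n ->
  has_length (quomod (submod_image (@bidual_map R V))) n.
Proof.
apply: (series_has_length RM bidual_embed_inj bidual_embed_image) => Phi.
split=> [/asboolP[v ->]|[v vE]]; first by exists v.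
by apply/asboolP; exists v; apply: bidual_embed_inj.
Qed.

End BidualLength.

(** * The bidual of a canonical ideal *)

Section CanonicalBidual.
Variables (R : comNzRingType) (M K : R -> Prop).
Hypotheses (RM : onedim M) (idK : is_ideal K) (canK : canonically_embedded M K).
Hypothesis nonprincipal :
  ~ exists k0, [/\ K k0, regular k0 & forall k, K k -> multiples k0 k].

Let idM := onedim_ideal RM.

(** The quotient [K : m] inside [R]; it is the one in the ring of fractions as
    soon as [K] lies in [x R] for some nonzerodivisor [x] of [m]. *)
Definition socle_ideal : R -> Prop := fun l => forall z, M z -> K (z * l).

Lemma socle_ideal_ideal : is_ideal socle_ideal.
Proof.
split=> [z _|a x y Lx Ly z Mz]; first by rewrite mulr0; apply: ideal0.
by rewrite mulrDr mulrCA; apply: (idK.2); [apply: Lx | apply: Ly].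
Qed.

Lemma sub_socle_ideal k : K k -> socle_ideal k.
Proof. by move=> Kk z _; apply: idealM. Qed.

(** When [K] lies in [x R], every homomorphism from [m] to [K] is
    multiplication by an element of [R], so the socle of [R / K] is all of
    [Ext^1(R / m, K)], hence simple. *)
Lemma socle_ideal_gen x : M x -> regular x -> (forall k, K k -> multiples x k) ->
  exists l0, [/\ socle_ideal l0, ~ K l0 &
    forall l, socle_ideal l -> exists c k, K k /\ l = c * l0 + k].
Proof.
move=> Mx rx Kx; have [E [Z [g [e1 [e0 [_ _ _ _ inj1 soc nsoc gen]]]]]] := canK.
have injK k k' : K k -> K k' -> k *: e1 = k' *: e1 -> k = k'.
  move=> Kk Kk' e; apply/eqP; rewrite -subr_eq0; apply/eqP/inj1.
    exact: idealB.
  by rewrite scalerBl e subrr.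
have [p [Kp pE]] := soc x Mx; have [l0 l0E] := Kx p Kp; rewrite mulrC in l0E.
have e0E z : M z -> K (z * l0) /\ z *: e0 = (z * l0) *: e1.
  move=> Mz; have [k [Kk kE]] := soc z Mz.
  suff -> : z * l0 = k by [].
  apply: (regular_inj rx); apply: injK; [|exact: idealM|].
    by rewrite mulrCA -l0E; apply: idealM.
  by rewrite mulrCA -l0E -!scalerA -pE -kE !scalerA mulrC.
exists l0; split.
- by move=> z /e0E[].
- by move=> Kl0; apply: nsoc; exists l0; split=> // z /e0E[].
move=> l Ll; have [|c [k [Kk kE]]] := gen (l *: e1).
  by move=> z Mz; exists (z * l); rewrite scalerA; split=> //; apply: Ll.
exists c, k; split=> //; apply: (regular_inj rx); apply: injK.
- exact: Ll.
- rewrite mulrDr mulrCA; apply: (idK.2); last exact: idealM.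
  by case: (e0E x Mx).
rewrite -scalerA kE // mulrDr scalerDr scalerDl !scalerA; congr (_ + _).
rewrite [x * c]mulrC -[(c * x) *: e0]scalerA (e0E x Mx).2 scalerA.
by rewrite mulrCA.
Qed.

Lemma unit_cancel_regular (a b c u v : R) :
  regular c -> u * v = 1 -> a * b = u * c -> regular a.
Proof.
move=> rc uv ab y ay0; apply: rc.
rewrite -[c * y]mul1r -uv [u * v]mulrC -mulrA [u * _]mulrA -ab mulrAC ay0.
by rewrite mul0r mulr0.
Qed.

Variable d : R.
Hypotheses (Kd : K d) (rd : regular d).

Let L := socle_ideal.
Let K' := dual_ideal d K.
Let J := dual_ideal d K'.

(** If [a k] were a unit times [d] then [k] would generate [K]. *)
Lemma dual_mul_sub_max a k : K' a -> K k -> exists t, M t /\ a * k = t * d.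
Proof.
move=> Ka Kk; have [u uE] := Ka k Kk.
have [Mu|/(onedim_unit RM)[v uv]] := EM (M u); first by exists u.
have ra := unit_cancel_regular rd uv uE.
have rk : regular k by apply: (unit_cancel_regular (b := a) rd uv); rewrite mulrC.
case: nonprincipal; exists k; split=> // k' Kk'; have [t tE] := Ka k' Kk'.
exists (v * t); apply: (regular_inj ra).
have -> : a * (v * t * k) = v * t * (a * k) by ring.
rewrite uE tE; have -> : v * t * (u * d) = u * v * (t * d) by ring.
by rewrite uv mul1r.
Qed.

(** Since [(R : K) K <= m], the product [(R : m) K] lies in [K**]; if this were
    [K], it would contradict [K : K = R]. *)
Lemma bidual_not_sub : exists y, J y /\ ~ K y.
Proof.
apply: contrapT => nJ.
have JK y : J y -> K y by move=> Jy; apply: contrapT => nKy; apply: nJ; exists y.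
have [x [Mx rx]] := onedim_regular RM.
have [w [nw wM]] := socle_mod_regular RM Mx rx.
apply: nw; apply: (canonical_endomorphism RM idK canK rx) => k Kk.
have wak a : K' a -> exists s, a * (w * k) = s * x * d.
  move=> Ka; have [t [Mt tE]] := dual_mul_sub_max Ka Kk.
  by have [s sE] := wM t Mt; exists s; rewrite mulrCA tE mulrA [w * t]mulrC sE.
have [j jE] := wak d (@dual_ideal_mem R d K).
have wk : w * k = x * j.
  by apply: (regular_inj rd); rewrite jE mulrC [j * x]mulrC.
exists j; split=> //; apply: JK => a Ka; have [s sE] := wak a Ka.
exists s; apply: (regular_inj rx).
have -> : x * (j * a) = a * (x * j) by ring.
by rewrite -wk sE; ring.
Qed.

Hypothesis Lgen : exists l0, [/\ L l0, ~ K l0 &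
  forall l, L l -> exists c k, K k /\ l = c * l0 + k].

(** An ideal strictly containing [K] meets the simple socle [L / K]. *)
Lemma socle_sub_bidual l : L l -> J l.
Proof.
have [y0 [Jy0 nKy0]] := bidual_not_sub.
have idJ : is_ideal J by apply: dual_ideal_ideal.
have [r [nKy yM]] := socle_above RM idK (canonical_faithful RM idK canK) nKy0.
have := idealM r idJ Jy0; move: (r * y0) nKy yM => y nKy yM Jy.
have [l0 [Ll0 nKl0 l0gen]] := Lgen; have [c [k [Kk yE]]] := l0gen y yM.
have Jk i : K i -> J i by apply: sub_bidual.
have [v cv] : exists v, c * v = 1.
  apply: (onedim_unit RM) => Mc; apply: nKy; rewrite yE.
  by apply: idealD => //; apply: Ll0.
have Jl0 : J l0.
  have -> : l0 = v * (y - k) by rewrite yE addrK mulrA [v * c]mulrC cv mul1r.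
  by apply: (idealM v idJ); apply: (idealB idJ) => //; apply: Jk.
by move=> /l0gen[c' [k' [Kk' ->]]]; apply: (idJ.2) => //; apply: Jk.
Qed.

(** [L] lies between [K] and its bidual. *)
Lemma dual_socle a : K' a <-> dual_ideal d L a.
Proof.
split=> [Ka l /socle_sub_bidual/(_ a Ka)|]; first by rewrite mulrC.
by apply: dual_idealS; apply: sub_socle_ideal.
Qed.

(** Otherwise [K] would be isomorphic to [m]; but [m : m] is larger than [R],
    unless [m], hence [K], is principal. *)
Lemma dual_mul_socle_sub_max b l : K' b -> L l -> exists t, M t /\ b * l = t * d.
Proof.
move=> Kb Ll; have [u uE] := (dual_socle b).1 Kb l Ll.
have [Mu|/(onedim_unit RM)[v uv]] := EM (M u); first by exists u.
have rb := unit_cancel_regular rd uv uE.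
have mK z : M z -> exists k, K k /\ z * d = b * k.
  move=> Mz; exists (z * l * v); split; first by apply: idealMr => //; apply: Ll.
  have -> : b * (z * l * v) = z * v * (b * l) by ring.
  by rewrite uE; have -> : z * v * (u * d) = u * v * (z * d) by [ring]; rewrite uv mul1r.
have [x [Mx rx]] := onedim_regular RM.
have [w [nw wM]] := socle_mod_regular RM Mx rx.
have [mw|nmw] := EM (forall z, M z -> exists t, M t /\ z * w = t * x).
  case: nw; apply: (canonical_endomorphism RM idK canK rx) => k Kk.
  have [t [Mt tE]] := dual_mul_sub_max Kb Kk; have [t' [Mt' t'E]] := mw t Mt.
  have [k' [Kk' k'E]] := mK t' Mt'; exists k'; split=> //.
  apply: (regular_inj rb); have -> : b * (w * k) = w * (b * k) by ring.
  rewrite tE; have -> : w * (t * d) = t * w * d by ring.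
  by rewrite t'E; have -> : t' * x * d = x * (t' * d) by [ring]; rewrite k'E; ring.
have [z0 [u' [v' [Mz0 u'v' z0w]]]] :
    exists z0 u' v', [/\ M z0, u' * v' = 1 & z0 * w = u' * x].
  apply: contrapT => nz; apply: nmw => z Mz; have [t tE] := wM z Mz.
  exists t; split=> //; apply: contrapT => /(onedim_unit RM)[t' tt'].
  by apply: nz; exists z, t, t'.
have Mz0' z : M z -> exists s, z = s * z0.
  move=> Mz; have [s sE] := wM z Mz; exists (v' * s).
  apply: (regular_inj rx).
  have -> : x * z = v' * z * (u' * x).
    by rewrite mulrACA [v' * u']mulrC u'v' mul1r mulrC.
  rewrite -z0w; have -> : v' * z * (z0 * w) = v' * z0 * (z * w) by ring.
  by rewrite sE; ring.
have rz0 : regular z0.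
  have [s sE] := Mz0' x Mx; move=> y y0; apply: rx.
  by rewrite sE -mulrA y0 mulr0.
have [k0 [Kk0 k0E]] := mK z0 Mz0.
case: nonprincipal; exists k0; split=> //.
  move=> y y0; apply: (regularM rz0 rd); rewrite k0E -mulrA y0.
  by rewrite mulr0.
move=> k Kk; have [t [/Mz0'[s sE] tE]] := dual_mul_sub_max Kb Kk.
exists s; apply: (regular_inj rb).
by rewrite tE sE -mulrA k0E mulrCA.
Qed.

(** Otherwise [R : L] would be generated by [i / d]. As [(i / d) L] lies in [m],
    the product of [i / d] with any element of [R : m] is again in [R : L], hence
    a multiple of [i / d], which makes [R : m] equal to [R]. *)
Lemma bidual_mul_sub_max a i : J a -> K' i -> exists t, M t /\ a * i = t * d.
Proof.
move=> Ja Ki; have [u uE] := Ja i Ki.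
have [Mu|/(onedim_unit RM)[v uv]] := EM (M u); first by exists u.
have ra := unit_cancel_regular rd uv uE.
have ri : regular i by apply: (unit_cancel_regular (b := a) rd uv); rewrite mulrC.
have Ki' j : K' j -> exists r, j = r * i.
  move=> Kj; have [r rE] := Ja j Kj; exists (r * v); apply: (regular_inj ra).
  have -> : a * (r * v * i) = r * v * (a * i) by ring.
  rewrite rE uE; have -> : r * v * (u * d) = u * v * (r * d) by ring.
  by rewrite uv mul1r.
have [x [Mx rx]] := onedim_regular RM.
have [w [nw wM]] := socle_mod_regular RM Mx rx.
have iwl l : L l -> exists s, i * w * l = s * x * d.
  move=> Ll; have [t [Mt tE]] := dual_mul_socle_sub_max Ki Ll.
  by have [s sE] := wM t Mt; exists s; rewrite mulrAC tE mulrAC sE.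
have [s0 s0E] := iwl d (sub_socle_ideal Kd).
have iw : i * w = s0 * x by apply: (regular_inj rd); rewrite mulrC s0E mulrC.
have [c cE] : exists c, s0 = c * i.
  apply/Ki'/dual_socle => l Ll; have [s sE] := iwl l Ll; exists s.
  by apply: (regular_inj rx); rewrite mulrA [x * s0]mulrC -iw sE mulrAC mulrC.
case: nw; exists c; apply: (regular_inj ri).
by rewrite iw cE mulrCA mulrA.
Qed.

End CanonicalBidual.

(** * The idealization of the maximal ideal *)

Section IdealizationRing.
Variables (R : comNzRingType) (m : ideal R).

Let A : comNzRingType := idealization (submod m).
Implicit Types (al be : A).

Definition ideal_part (al : A) : R := val al.2.

Lemma ideal_part_mem al : ideal_part al \in m.
Proof. exact: (valP al.2). Qed.

Lemma idealization_ext al be :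
  al.1 = be.1 -> ideal_part al = ideal_part be -> al = be.
Proof. by move=> e1 e2; apply: injective_projections => //; apply: val_inj. Qed.

Lemma idealization_mul1E al be : (al * be).1 = al.1 * be.1.
Proof. by []. Qed.

Lemma idealization_mul2E al be :
  ideal_part (al * be) = al.1 * ideal_part be + be.1 * ideal_part al.
Proof.
by rewrite -!ideal_valZ -ideal_valD.
Qed.

Lemma idealization_add1E al be : (al + be).1 = al.1 + be.1.
Proof. by []. Qed.

Lemma idealization_add2E al be :
  ideal_part (al + be) = ideal_part al + ideal_part be.
Proof. exact: (ideal_valD al.2 be.2). Qed.

Definition idealizationE := (idealization_mul1E, idealization_mul2E,
  idealization_add1E, idealization_add2E).

Definition scalar (a : R) : A := (a, 0).

Lemma ideal_part_scalar a : ideal_part (scalar a) = 0. Proof. by []. Qed.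

Definition nilpart (b : R) (mb : b \in m) : A := (0, Submod mb).

Lemma ideal_part_nilpart b (mb : b \in m) : ideal_part (nilpart mb) = b.
Proof. by []. Qed.

Lemma scalar_mul1 a al : (scalar a * al).1 = a * al.1. Proof. by []. Qed.

Lemma scalar_mul2 a al : ideal_part (scalar a * al) = a * ideal_part al.
Proof. by rewrite idealization_mul2E ideal_part_scalar mulr0 addr0. Qed.

Definition idealization_max : A -> Prop := fun al => al.1 \in m.

Lemma idealization_max_ideal : is_ideal idealization_max.
Proof.
split; first exact: (ideal0 (mem_is_ideal m)).
by move=> a x y mx my; apply: (mem_is_ideal m).2.
Qed.

Hypothesis cm : cohen_macaulay m 1.
Let Rm := cohen_macaulay_onedim cm.
Let idm := mem_is_ideal m.

Lemma idealization_noetherian : noetherian A.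
Proof.
move=> I; have idI := mem_is_ideal I.
pose I1 (a : R) := exists al, al \in I /\ al.1 = a.
have idI1 : is_ideal I1.
  split; first by exists 0; split=> //; apply: (ideal0 idI).
  move=> a _ _ [al [Ial <-]] [be [Ibe <-]]; exists (scalar a * al + be).
  by split=> //; apply: (idI.2).
pose I2 (b : R) := exists al, [/\ al \in I, al.1 = 0 & ideal_part al = b].
have idI2 : is_ideal I2.
  split; first by exists 0; split=> //; apply: (ideal0 idI).
  move=> a _ _ [al [Ial al0 <-]] [be [Ibe be0 <-]]; exists (scalar a * al + be).
  split; [exact: (idI.2) | by rewrite !idealizationE al0 be0 mulr0 addr0 |].
  by rewrite idealization_add2E scalar_mul2.
have noe := onedim_noetherian Rm.
have [n1 [e1 e1P]] := noe (mk_ideal idI1).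
have [n2 [e2 e2P]] := noe (mk_ideal idI2).
have /choice[f1 f1P] i : exists al : submod I, (val al).1 = val (e1 i).
  have /(mk_idealE idI1)[al [Ial alE]] := valP (e1 i).
  by exists (Submod Ial).
have /choice[f2 f2P] i : exists al : submod I,
    (val al).1 = 0 /\ ideal_part (val al) = val (e2 i).
  have /(mk_idealE idI2)[al [Ial al0 alE]] := valP (e2 i).
  by exists (Submod Ial).
exists (n1 + n2)%N, (fun i => match split i with inl j => f1 j | inr j => f2 j end).
have sum1 n (F : 'I_n -> submod I) : (val (\sum_i F i)).1 = \sum_i (val (F i)).1.
  apply: (big_morph (fun u : submod I => (val u : A).1)) => [u v|].
    by rewrite ideal_valD.
  by rewrite raddf0.
have sum2 n (F : 'I_n -> submod I) :
    ideal_part (val (\sum_i F i)) = \sum_i ideal_part (val (F i)).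
  apply: (big_morph (fun u : submod I => ideal_part (val u))) => [u v|].
    by rewrite ideal_valD idealization_add2E.
  by rewrite raddf0.
move=> x.
have I1x : (val x).1 \in mk_ideal idI1.
  by apply/(mk_idealE idI1); exists (val x); split=> //; apply: (valP x).
have [c1 c1E] := e1P (Submod I1x).
have [y xE] : exists y, x = y + \sum_i scalar (c1 i) *: f1 i.
  by exists (x - \sum_i scalar (c1 i) *: f1 i); rewrite subrK.
have y1 : (val y).1 = 0.
  apply: (addIr (val (\sum_i scalar (c1 i) *: f1 i) : A).1).
  rewrite -idealization_add1E -ideal_valD -xE sum1 add0r.
  rewrite -[(val x : A).1 in LHS]/(val (Submod I1x)) c1E raddf_sum.
  by apply: eq_bigr => i _; rewrite !ideal_valZ idealization_mul1E f1P.
have I2y : ideal_part (val y) \in mk_ideal idI2.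
  by apply/(mk_idealE idI2); exists (val y); split=> //; apply: (valP y).
have [c2 c2E] := e2P (Submod I2y).
have yE : y = \sum_i scalar (c2 i) *: f2 i.
  apply: val_inj; apply: idealization_ext.
    rewrite y1 sum1 big1 // => i _.
    by rewrite ideal_valZ idealization_mul1E (f2P i).1 mulr0.
  apply: etrans (esym (sum2 _ (fun i => scalar (c2 i) *: f2 i))).
  rewrite -[LHS]/(val (Submod I2y)) c2E raddf_sum.
  by apply: eq_bigr => i _; rewrite !ideal_valZ scalar_mul2 (f2P i).2.
exists (fun i => match split i with inl j => scalar (c1 j) | inr j => scalar (c2 j) end).
rewrite big_split_ord xE yE addrC; congr (_ + _); apply: eq_bigr => i _.
  by rewrite -[lshift n2 i]/(unsplit (inl i)) unsplitK.
by rewrite -[rshift n1 i]/(unsplit (inr i)) unsplitK.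
Qed.

Lemma idealization_unit al : ~ idealization_max al -> exists be, al * be = 1.
Proof.
move=> /(onedim_unit Rm)[b ab].
have mb : - (b * b * ideal_part al) \in m.
  by apply: (idealN idm); apply: (idealM _ idm); apply: ideal_part_mem.
exists (b, Submod mb); apply: idealization_ext => //.
rewrite idealization_mul2E /= -[ideal_part (b, _)]/(- (b * b * ideal_part al)).
by rewrite mulrN !mulrA ab mul1r addNr.
Qed.

Lemma prime_nilpart P b (mb : b \in m) : is_prime P -> P (nilpart mb).
Proof.
move=> [idP _ prP]; suff /prP[] : P (nilpart mb * nilpart mb) by [].
have -> : nilpart mb * nilpart mb = 0; last exact: ideal0.
by apply: idealization_ext; rewrite idealizationE /= ?mul0r ?addr0.
Qed.

(** The ideal [0 + m eps] is nilpotent, so prime ideals of [A] and [R] are the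
    same. *)
Lemma prime_scalar P al : is_prime P -> P al <-> P (scalar al.1).
Proof.
move=> prP; have [idP _ _] := prP; have Pn := prime_nilpart (ideal_part_mem al) prP.
have alE : al = scalar al.1 + nilpart (ideal_part_mem al).
  apply: idealization_ext; rewrite idealizationE /= ?addr0 //.
  by rewrite ideal_part_scalar add0r.
split=> [Pal|Pal]; last by rewrite alE; apply: idealD.
have -> : scalar al.1 = al - nilpart (ideal_part_mem al) by rewrite {2}alE addrK.
exact: idealB.
Qed.

Lemma prime_chain_scalar n : prime_chain A n -> prime_chain R n.
Proof.
move=> [P [prP stP]].
have primeP i : (i <= n)%N -> is_prime (fun al => al \in P i).
  move=> /prP[P1 Pm]; split=> //; first exact: mem_is_ideal.
  exact/negP.
have idQ i : is_ideal (fun a : R => scalar a \in P i).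
  split; first exact: (ideal0 (mem_is_ideal (P i))).
  move=> a x y Px Py; have -> : scalar (a * x + y) = scalar a * scalar x + scalar y.
    apply: idealization_ext => //; rewrite idealization_add2E scalar_mul2.
    by rewrite !ideal_part_scalar mulr0 addr0.
  exact: (mem_is_ideal (P i)).2.
exists (fun i => mk_ideal (idQ i)); split.
  move=> i /primeP[_ P1 Pm]; split; first by apply/negP => /(mk_idealE (idQ i)).
  move=> a b /(mk_idealE (idQ i)) Pab.
  have [|H|H] := Pm (scalar a) (scalar b).
  - have -> : scalar a * scalar b = scalar (a * b); last by [].
    by apply: idealization_ext => //; rewrite scalar_mul2 !ideal_part_scalar mulr0.
  - by left; apply/(mk_idealE (idQ i)).
  - by right; apply/(mk_idealE (idQ i)).
move=> i ln; have [PP nPP] := stP i ln; split.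
  by move=> a /(mk_idealE (idQ i))/PP Pa; apply/(mk_idealE (idQ i.+1)).
move=> e; apply: nPP => al; apply/idP/idP; first exact: PP.
move=> /(prime_scalar al (primeP i.+1 ln)) Pal.
apply/(prime_scalar al (primeP i (ltnW ln))); apply/(mk_idealE (idQ i)).
by rewrite e; apply/(mk_idealE (idQ i.+1)).
Qed.

Lemma prime_chain_idealization n : prime_chain R n -> prime_chain A n.
Proof.
move=> [P [prP stP]].
have idQ i : is_ideal (fun al : A => al.1 \in P i).
  split; first exact: (ideal0 (mem_is_ideal (P i))).
  by move=> a x y; apply: (mem_is_ideal (P i)).2.
exists (fun i => mk_ideal (idQ i)); split.
  move=> i /prP[P1 Pm]; split.
    by apply/negP => /(mk_idealE (idQ i)); apply/negP.
  move=> a b /(mk_idealE (idQ i))/Pm[H|H]; [left|right].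
    exact/(mk_idealE (idQ i)).
  exact/(mk_idealE (idQ i)).
move=> i ln; have [PP nPP] := stP i ln; split.
  by move=> a /(mk_idealE (idQ i))/PP Pa; apply/(mk_idealE (idQ i.+1)).
move=> e; apply: nPP => a; have := e (scalar a).
have E j : (scalar a \in mk_ideal (idQ j)) = (a \in P j).
  by apply/idP/idP => [/(mk_idealE (idQ j))//|H]; apply/(mk_idealE (idQ j)).
by rewrite !E.
Qed.

Lemma scalar_regular a : regular a -> regular (scalar a).
Proof.
move=> ra al al0; apply: idealization_ext.
  by apply: ra; rewrite -scalar_mul1 al0.
by apply: ra; rewrite -scalar_mul2 al0.
Qed.

Definition idealization_max_id : ideal A := mk_ideal idealization_max_ideal.

Lemma idealization_maxE al : (al \in idealization_max_id) = (al.1 \in m).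
Proof. by apply/idP/idP => /(mk_idealE idealization_max_ideal). Qed.

Lemma idealization_onedim : onedim (fun al : A => al \in idealization_max_id).
Proof.
have m1 : ~ idealization_max 1 := onedim_one Rm.
split.
- exact: idealization_noetherian.
- exact: mem_is_ideal.
- by rewrite idealization_maxE.
- by move=> al; rewrite idealization_maxE; apply: idealization_unit.
- move=> P Q prP prQ QP [z [mz nPz]] al Pal.
  have pr1 S : is_prime S -> is_prime (fun a => S (scalar a)).
    move=> prS; have [idS S1 Sm] := prS; split=> //.
      split; first exact: (ideal0 idS).
      move=> a x y Sx Sy.
      by apply/(prime_scalar (scalar a * scalar x + scalar y) prS)/(idS.2).
    by move=> a b /(prime_scalar (scalar a * scalar b) prS)/Sm.
  apply/(prime_scalar _ prQ).
  apply: (onedim_minimal Rm (pr1 _ prP) (pr1 _ prQ));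
    last exact: (prime_scalar al prP).1 Pal.
    by move=> x; apply: QP.
  exists z.1; split; first by rewrite -idealization_maxE.
  by move/(prime_scalar z prP).
- have [x [mx rx]] := onedim_regular Rm; exists (scalar x).
  by rewrite idealization_maxE; split=> //; apply: scalar_regular.
Qed.

Lemma idealization_cohen_macaulay : cohen_macaulay idealization_max_id 1.
Proof.
have AM := idealization_onedim; have [_ _ [chain1 dim1] _] := cm.
split.
- apply: unit_local_ring; first exact/negP/(onedim_one AM).
  by move=> al /negP; apply: (onedim_unit AM).
- exact: idealization_noetherian.
- split; first exact: prime_chain_idealization.
  by move=> n /prime_chain_scalar; apply: dim1.
apply: (@depth_one _ _ A^o [the {linear A^o -> A^o} of idfun]) => //.
by exists 1 => y /=; rewrite mul1r.
Qed.

End IdealizationRing.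

(** An injective module with injective cokernel, as a resolution. *)
Section ShortResolution.
Variables (R : comNzRingType) (V E Z : lmodType R).
Variables (f : {linear V -> E}) (g : {linear E -> Z}).
Hypothesis ses : injective_ses f g.

Let zero_module : lmodType R := 'M[R]_(0, 0).

Definition short_term (i : nat) : lmodType R :=
  match i with 0 => E | 1 => Z | _ => zero_module end.

Definition short_diff (i : nat) : {linear short_term i -> short_term i.+1} :=
  match i with
  | 0 => g
  | 1 => [the {linear Z -> zero_module} of \0%R]
  | _ => [the {linear zero_module -> zero_module} of \0%R]
  end.

Lemma zero_module0 (x : zero_module) : x = 0.
Proof. exact: flatmx0. Qed.

Lemma short_injective i : injective_module (short_term i).
Proof.
case: ses => _ injE injZ _ _; case: i => [|[|i]] //=.
by apply: zero_module_injective; apply: zero_module0.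
Qed.

Lemma short_exact i x : short_diff i.+1 x = 0 <-> exists y, x = short_diff i y.
Proof.
case: ses => _ _ _ gsurj _; case: i x => [|i] x /=.
  by split=> // _; have [y <-] := gsurj x; exists y.
split=> [_|_]; last by case: i x.
by exists 0; rewrite linear0; apply: zero_module0.
Qed.

Lemma short_aug_inj : injective f. Proof. by case: ses. Qed.

Lemma short_exact0 x : short_diff 0 x = 0 <-> exists y, x = f y.
Proof. by case: ses. Qed.

Definition short_resolution : inj_resolution V :=
  @InjResolution R V short_term f short_diff short_injective short_aug_inj
    short_exact0 short_exact.

Lemma short_finite_injdim : finite_injdim V.
Proof.
exists short_resolution, 1%N => -[|[|i]] //= _ x; exact: zero_module0.
Qed.

End ShortResolution.

Section Coinduced.
Variables (R : comNzRingType) (m : ideal R).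

Let A : comNzRingType := idealization (submod m).

(** [Hom_R (A, E)]: a homomorphism is given by its restriction to [m eps] and
    its value at [1]. *)
Definition coinduced (E : lmodType R) : Type := (Hom (submod m) E * E)%type.

Section Module.
Variable E : lmodType R.
Local Notation C := (coinduced E).

HB.instance Definition _ := GRing.Zmodule.copy C (Hom (submod m) E * E)%type.

Definition coinduced_scale (al : A) (x : C) : C :=
  (al.1 *: x.1, al.1 *: x.2 + x.1 al.2).

Lemma coinduced_scaleA (a b : A) x :
  coinduced_scale a (coinduced_scale b x) = coinduced_scale (a * b) x.
Proof.
congr pair => /=; first by rewrite scalerA.
transitivity (a.1 *: (b.1 *: x.2 + x.1 b.2) + b.1 *: x.1 a.2); first by [].
transitivity ((a.1 * b.1) *: x.2 + x.1 (a.1 *: b.2 + b.1 *: a.2)); last by [].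
rewrite [x.1 (_ + _)]linearD [x.1 (a.1 *: _)]linearZ [x.1 (b.1 *: _)]linearZ.
by rewrite scalerDr scalerA addrA.
Qed.

Lemma coinduced_scale1 : left_id 1 coinduced_scale.
Proof.
move=> [h e]; congr pair => /=; first by rewrite scale1r.
by rewrite scale1r linear0 addr0.
Qed.

Lemma coinduced_scaleDr : right_distributive coinduced_scale +%R.
Proof.
move=> a x y; congr pair; first exact: (scalerDr a.1 x.1 y.1).
transitivity (a.1 *: (x.2 + y.2) + (x.1 a.2 + y.1 a.2)); first by [].
by rewrite scalerDr addrACA.
Qed.

Lemma coinduced_scaleDl x : {morph coinduced_scale^~ x : a b / a + b}.
Proof.
move=> a b; congr pair; first exact: (scalerDl x.1 a.1 b.1).
transitivity ((a.1 + b.1) *: x.2 + x.1 (a.2 + b.2)); first by [].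
by rewrite scalerDl linearD addrACA.
Qed.

HB.instance Definition _ := GRing.Zmodule_isLmodule.Build A C
  coinduced_scaleA coinduced_scale1 coinduced_scaleDr coinduced_scaleDl.

End Module.

Definition restriction (V : lmodType A) : Type := V.

Section Restriction.
Variable V : lmodType A.
Local Notation W := (restriction V).
HB.instance Definition _ := GRing.Zmodule.on W.

Definition restriction_scale (a : R) (v : W) : W := (scalar m a : A) *: (v : V).

Lemma scalarM (a b : R) : scalar m a * scalar m b = scalar m (a * b).
Proof.
by apply: idealization_ext => //; rewrite scalar_mul2 !ideal_part_scalar mulr0.
Qed.

Lemma scalarD (a b : R) : scalar m a + scalar m b = scalar m (a + b).
Proof.
by apply: idealization_ext; rewrite // idealization_add2E !ideal_part_scalar addr0.
Qed.

Lemma restriction_scaleA a b v :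
  restriction_scale a (restriction_scale b v) = restriction_scale (a * b) v.
Proof. by rewrite /restriction_scale scalerA scalarM. Qed.

Lemma restriction_scale1 : left_id 1 restriction_scale.
Proof. by move=> v; apply: scale1r. Qed.

Lemma restriction_scaleDr : right_distributive restriction_scale +%R.
Proof. by move=> a u v; apply: scalerDr. Qed.

Lemma restriction_scaleDl v : {morph restriction_scale^~ v : a b / a + b}.
Proof. by move=> a b; rewrite /restriction_scale -scalarD scalerDl. Qed.

HB.instance Definition _ := GRing.Zmodule_isLmodule.Build R W
  restriction_scaleA restriction_scale1 restriction_scaleDr restriction_scaleDl.

Lemma restriction_scaleE (a : R) (v : W) : a *: v = (scalar m a : A) *: (v : V).
Proof. by []. Qed.

End Restriction.

Definition eps (b : submod m) : A := (0, b).

Lemma eps_linear (a : R) (b c : submod m) :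
  eps (a *: b + c) = scalar m a * eps b + eps c.
Proof.
apply: idealization_ext.
  by rewrite idealization_add1E scalar_mul1 mulr0 addr0.
by rewrite idealization_add2E scalar_mul2 -ideal_valZ -ideal_valD.
Qed.

(** Adjunction: [A]-homomorphisms to [Hom_R (A, E)] are [R]-homomorphisms to
    [E]. *)
Lemma coinduced_injective (E : lmodType R) :
  injective_module E -> injective_module (coinduced E).
Proof.
move=> injE U V f g injf.
have linf : linear (f : restriction U -> restriction V).
  by move=> a u v; rewrite !restriction_scaleE linearP.
have ling : linear (fun u : restriction U => (g u).2).
  move=> a u v; rewrite restriction_scaleE linearP /=.
  by rewrite linear0 addr0.
have [h hP] := injE _ _ (mk_linear linf) (mk_linear ling) injf.
have linh (v : V) : linear (fun b : submod m => h (eps b *: v : V)).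
  move=> a b c; rewrite eps_linear scalerDl -scalerA.
  by rewrite -[scalar m a *: _]/(a *: (eps b *: v : restriction V)) linearP.
have epsM b (al : A) : eps b * al = scalar m al.1 * eps b.
  apply: idealization_ext; rewrite ?idealization_mul1E ?scalar_mul2.
    by rewrite mul0r mulr0.
  by rewrite idealization_mul2E mul0r add0r.
have alE (al : A) : al = scalar m al.1 + eps al.2.
  apply: idealization_ext; first by rewrite idealization_add1E addr0.
  by rewrite idealization_add2E ideal_part_scalar add0r.
have linH : linear (fun v : V => (mk_linear (linh v), h v) : coinduced E).
  move=> al u v; congr pair.
    apply: Hom_ext => b.
    transitivity (h (eps b *: (al *: u + v))); first by [].
    rewrite scalerDr linearD scalerA epsM -scalerA.
    rewrite -[scalar m al.1 *: _]/(al.1 *: (eps b *: u : restriction V)).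
    by rewrite linearZ.
  transitivity (al.1 *: h u + h (eps al.2 *: u) + h v); last by [].
  rewrite linearD {1}[al]alE scalerDl linearD; congr (_ + _ + _).
  rewrite -[scalar m al.1 *: _]/(al.1 *: (u : restriction V)).
  by rewrite linearZ.
exists (mk_linear linH) => u; apply: injective_projections; last exact: hP.
apply: Hom_ext => b /=; rewrite -linearZ [LHS]hP /= linearZ /=.
by rewrite scale0r add0r.
Qed.

End Coinduced.

(** * The canonical ideal of the idealization *)

Section IdealizationCanonical.
Variables (R : comNzRingType) (m : ideal R) (K : R -> Prop).
Hypotheses (cm : cohen_macaulay m 1) (idK : is_ideal K).
Variables (E Z : lmodType R) (g : {linear E -> Z}) (e1 e0 : E).
Hypothesis embK : canonical_embedding (fun x : R => x \in m) K g e1 e0.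
Variable x : R.
Hypotheses (mx : x \in m) (rx : regular x).
Hypothesis Kx : forall k, K k -> multiples x k.

Let A : comNzRingType := idealization (submod m).
Let M : R -> Prop := fun z => z \in m.
Let L := socle_ideal M K.
Let mA := idealization_max_id m.
Let idm : is_ideal M := mem_is_ideal m.
Let canK : canonically_embedded M K :=
  ex_intro _ E (ex_intro _ Z (ex_intro _ g (ex_intro _ e1 (ex_intro _ e0 embK)))).
Let Rm : onedim M := cohen_macaulay_onedim cm.

Definition pair_ideal (I1 I2 : R -> Prop) : A -> Prop :=
  fun al => I1 al.1 /\ I2 (ideal_part al).

Lemma pair_ideal_ideal I1 I2 : is_ideal I1 -> is_ideal I2 ->
  (forall a b, I1 a -> b \in m -> I2 (a * b)) -> is_ideal (pair_ideal I1 I2).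
Proof.
move=> id1 id2 I12; split; first by split; [apply: ideal0 id1 | apply: ideal0 id2].
move=> al be ga [I1be I2be] [I1ga I2ga]; split; first exact: (id1.2).
rewrite idealization_add2E idealization_mul2E -addrA; apply: (id2.2) => //.
by apply: idealD => //; apply: I12 => //; apply: ideal_part_mem.
Qed.

(** [Hom_R (A, K)], which is the canonical module of [A]. *)
Definition canonical_pair : A -> Prop := pair_ideal L K.

Lemma canonical_pair_ideal : is_ideal canonical_pair.
Proof.
apply: pair_ideal_ideal => //; first exact: socle_ideal_ideal.
by move=> a b La mb; rewrite mulrC; apply: La.
Qed.

Definition canonical_pair_id : ideal A := mk_ideal canonical_pair_ideal.

Let D : lmodType A := submod canonical_pair_id.

Lemma canonical_pairP (u : D) : canonical_pair (val u).
Proof. exact/(mk_idealE canonical_pair_ideal)/(valP u). Qed.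

Lemma mult_linear (a : R) : linear (fun z : submod m => (a * val z) *: e1).
Proof. by move=> c y z; rewrite ideal_valD ideal_valZ mulrDr scalerDl mulrCA scalerA. Qed.

Definition mult_hom (a : R) : Hom (submod m) E := mk_linear (mult_linear a).

Lemma pair_aug_linear :
  linear (fun u : D => (mult_hom (val u).1, ideal_part (val u) *: e1) : coinduced m E).
Proof.
move=> al u v; congr pair.
  apply: Hom_ext => z.
  transitivity (((val (al *: u + v) : A).1 * val z) *: e1); first by [].
  rewrite ideal_valD ideal_valZ idealization_add1E idealization_mul1E.
  by rewrite mulrDl scalerDl -mulrA -scalerA.
transitivity (al.1 *: (ideal_part (val u) *: e1) + ((val u).1 * ideal_part al) *: e1 +
  ideal_part (val v) *: e1); last by [].
rewrite ideal_valD ideal_valZ idealization_add2E idealization_mul2E.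
by rewrite !scalerDl scalerA.
Qed.

Definition pair_aug : {linear D -> coinduced m E} := mk_linear pair_aug_linear.

Lemma pair_augE (u : D) :
  pair_aug u = (mult_hom (val u).1, ideal_part (val u) *: e1).
Proof. by []. Qed.

Lemma coinduced_map_linear : linear (fun y : coinduced m E =>
  ([the {linear submod m -> Z} of g \o y.1], g y.2) : coinduced m Z).
Proof.
move=> al y z; congr pair.
  apply: Hom_ext => b.
  transitivity (g (al.1 *: y.1 b + z.1 b)); first by [].
  by rewrite linearP.
transitivity (g (al.1 *: y.2 + y.1 al.2 + z.2)); first by [].
by rewrite linearD linearD linearZ.
Qed.

Definition coinduced_map := mk_linear coinduced_map_linear.

(** Every homomorphism from [m] to [K] is multiplication by an element of
    [L], because [K] lies in [x R]. *)
Lemma mult_hom_mem (h : Hom (submod m) E) :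
  (forall z, exists k, K k /\ h z = k *: e1) ->
  exists u, L u /\ h = mult_hom u.
Proof.
move=> hK; have [_ _ _ _ inj1 _ _ _] := embK.
have [p [Kp pE]] := hK (Submod mx); have [u uE] := Kx Kp.
have hE (z : submod m) : K (u * val z) /\ h z = (u * val z) *: e1.
  have [k [Kk kE]] := hK z; suff -> : u * val z = k by [].
  apply: (regular_inj rx); apply/eqP; rewrite -subr_eq0; apply/eqP/inj1.
    apply: idealB => //; last exact: idealM.
    by rewrite mulrA [x * u]mulrC -uE; apply: idealMr.
  rewrite scalerBl -[(x * k) *: e1]scalerA -kE mulrA [x * u]mulrC -uE [p * _]mulrC.
  rewrite -[(val z * p) *: e1]scalerA -pE.
  rewrite -!linearZ; apply/eqP; rewrite subr_eq0; apply/eqP; congr (h _).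
  by apply: val_inj; rewrite !ideal_valZ mulrC.
exists u; split; last by apply: Hom_ext => z; case: (hE z).
by move=> z mz; rewrite mulrC; case: (hE (Submod mz)).
Qed.

(** A homomorphism from [m] to [Z] lifts to [E], because it extends to [R]: this
    is [Ext^1 (m, K) = 0], and it makes the sequence exact on the right. *)
Lemma pair_ses : injective_ses pair_aug coinduced_map.
Proof.
have [injE injZ gsurj gf inj1 _ _ _] := embK.
split.
- move=> u v uv; apply: val_inj.
  have uv1 : ((val u).1 * x) *: e1 = ((val v).1 * x) *: e1.
    exact: (congr1 (fun t : coinduced m E => t.1 (Submod mx)) uv).
  have uv2 : ideal_part (val u) *: e1 = ideal_part (val v) *: e1.
    exact: (congr1 (fun t : coinduced m E => t.2) uv).
  have [Lu Ku] := canonical_pairP u; have [Lv Kv] := canonical_pairP v.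
  have inj k k' : K k -> K k' -> k *: e1 = k' *: e1 -> k = k'.
    move=> Kk Kk' e; apply/eqP; rewrite -subr_eq0; apply/eqP/inj1.
      exact: idealB.
    by rewrite scalerBl e subrr.
  apply: idealization_ext; last exact: inj.
  apply: (regular_inj rx); apply: inj; [exact: Lu | exact: Lv |].
  by rewrite mulrC uv1 mulrC.
- exact: coinduced_injective.
- exact: coinduced_injective.
- move=> [h z]; have [z1 zE] := injective_extend_ideal h injZ.
  have [y yE] := gsurj z1; have [y2 y2E] := gsurj z.
  have lin : linear (fun b : submod m => (val b : R) *: y).
    by move=> c a b; rewrite ideal_valD ideal_valZ scalerDl scalerA.
  exists (mk_linear lin, y2); congr pair => //.
  by apply: Hom_ext => b; rewrite zE -yE -linearZ.
move=> [h y]; split=> [e|[u ->]].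
  have hK z : exists k, K k /\ h z = k *: e1.
    by apply/gf; have := congr1 (fun t : coinduced m Z => t.1 z) e.
  have [u [Lu hE]] := mult_hom_mem hK.
  have [k [Kk yE]] : exists k, K k /\ y = k *: e1.
    by apply/gf; have := congr1 (fun t : coinduced m Z => t.2) e.
  have mk : k \in m by have [r ->] := Kx Kk; apply: (idealM r idm).
  have Duk : ((u, Submod mk) : A) \in canonical_pair_id.
    by apply/(mk_idealE canonical_pair_ideal).
  by exists (Submod Duk); rewrite pair_augE hE yE.
have [Lu Ku] := canonical_pairP u.
congr pair; last by apply/gf; exists (ideal_part (val u)).
apply: Hom_ext => z; apply/gf; exists ((val u).1 * val z); split=> //.
by rewrite mulrC; apply: Lu; apply: (valP z).
Qed.

(** [e0] placed in the coordinate of values at [1] generates, since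
    [Hom_A (A / m_A, Hom_R (A, E)) = Hom_R (R / m, E)]. *)
Lemma pair_socle_generator :
  socle_generator (fun al : A => al \in mA) pair_aug ((0, e0) : coinduced m E).
Proof.
have [injE injZ gsurj gf inj1 soc nsoc gen] := embK.
have scaleE (al : A) (y : coinduced m E) :
  al *: y = (al.1 *: y.1, al.1 *: y.2 + y.1 al.2) :> coinduced m E by [].
have inD (u k : R) : L u -> K k -> exists v : D, (val v).1 = u /\ ideal_part (val v) = k.
  move=> Lu Kk; have mk : k \in m by have [r ->] := Kx Kk; apply: (idealM r idm).
  have Duk : ((u, Submod mk) : A) \in canonical_pair_id.
    by apply/(mk_idealE canonical_pair_ideal).
  by exists (Submod Duk).
have L0 : L 0 by apply: (ideal0 (socle_ideal_ideal _ idK)).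
have mult0 : mult_hom 0 = 0 by apply: Hom_ext => z; rewrite /= mul0r scale0r.
split.
- move=> al; rewrite idealization_maxE => /soc[k [Kk kE]].
  have [v [v1 v2]] := inD 0 k L0 Kk; exists v.
  by rewrite pair_augE v1 v2 mult0 scaleE scaler0 kE addr0.
- move=> [v vE]; apply: nsoc; exists (ideal_part (val v)).
  split=> [|z mz]; first by case: (canonical_pairP v).
  have mAz : scalar m z \in mA by rewrite idealization_maxE.
  have e : z *: e0 + 0 = ideal_part (scalar m z * val v : A) *: e1.
    by rewrite -ideal_valZ; exact: (congr1 (fun t : coinduced m E => t.2) (vE _ mAz)).
  by rewrite -[z *: e0]addr0 e scalar_mul2.
move=> [h e] hm; have hK z : exists k, K k /\ h z = k *: e1.
  have mAz : eps z \in mA by rewrite idealization_maxE (ideal0 idm).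
  have [v vE] := hm _ mAz; exists (ideal_part (val v)).
  split; first by case: (canonical_pairP v).
  have e' : 0 *: e + h z = ideal_part (val v) *: e1.
    exact: (congr1 (fun t : coinduced m E => t.2) vE).
  by rewrite -e' scale0r add0r.
have [u [Lu hE]] := mult_hom_mem hK.
have [|c [k [Kk kE]]] := gen e.
  move=> z mz; have mAz : scalar m z \in mA by rewrite idealization_maxE.
  have [v vE] := hm _ mAz; exists (ideal_part (val v)).
  split; first by case: (canonical_pairP v).
  have e' : z *: e + h 0 = ideal_part (val v) *: e1.
    exact: (congr1 (fun t : coinduced m E => t.2) vE).
  by rewrite -e' linear0 addr0.
have [v [v1 v2]] := inD u k Lu Kk; exists (scalar m c), v => al.
rewrite idealization_maxE => mal.
rewrite pair_augE v1 v2 -hE; congr pair.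
  by rewrite /= scaler0 add0r.
rewrite scaleE /= kE //; congr (_ *: (_ + _) + _).
  by rewrite addr0.
by rewrite scaler0 add0r.
Qed.

Lemma pair_canonical_ideal : canonical_ideal mA canonical_pair_id.
Proof.
have Am := idealization_onedim cm; have cmA := idealization_cohen_macaulay cm.
have [_ noeA dimA _] := cmA.
have depD : depth mA D 1.
  apply: (@depth_one _ _ _ [the {linear D -> A^o} of val]) => //; first exact: val_inj.
  have [d [Kd rd]] := canonical_regular Rm idK canK.
  have Dd : scalar m d \in canonical_pair_id.
    apply/(mk_idealE canonical_pair_ideal); split; last exact: (ideal0 idK).
    exact: sub_socle_ideal.
  by exists (Submod Dd); apply: scalar_regular.
exists D; split; last first.
  by exists [the {linear D -> D} of idfun]; exists idfun.
split.
- exact: noeA.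
- by exists 1%N.
- exists 1%N, (short_resolution pair_ses); split=> //.
  exact: (@ext1_of_socle_generator _ mA D (short_resolution pair_ses) Am
    ((0, e0) : coinduced m E) pair_socle_generator).
- exact: short_finite_injdim pair_ses.
Qed.

End IdealizationCanonical.

(** * Comparing the two bidegrees *)

Lemma submodClosed_ext (R : comNzRingType) (V : lmodType R) (S T : submodClosed V) :
  submod_eq S T -> S = T.
Proof.
case: S T => [s [[s1] [s2]]] [t [[t1] [t2]]] st.
have e : s = t by apply/funext => x; exact: st.
by subst t; rewrite (Prop_irrelevance s1 t1) (Prop_irrelevance s2 t2).
Qed.

(** The first term of a longer series would be a proper nonzero submodule of a
    simple module. *)
Lemma length_one_unique (R : comNzRingType) (V : lmodType R) n :
  has_length V 1 -> has_length V n.+1 -> n = 0%N.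
Proof.
move=> [S [S0 S1 Sst]] [T [T0 _ Tst]]; case: n Tst => // n Tst; exfalso.
have [_ _ simple] := Sst 0%N isT.
have [_ n01 _] := Tst 0%N isT; have [sub12 n12 _] := Tst 1%N isT.
have [x /S0 -> //||e|e] := simple (T 1%N); first exact: rpred0.
- by move=> x _; apply: S1.
- apply: n01 => x; rewrite e; apply/idP/idP => [/T0 ->|/S0 ->]; exact: rpred0.
- apply: n12 => x; apply/idP/idP => [/sub12//|_]; rewrite e; exact: S1.
Qed.

Lemma finite_injdim_iso (R : comNzRingType) (V W : lmodType R) :
  isomorphic V W -> finite_injdim W -> finite_injdim V.
Proof.
move=> [h bijh] [I [n In]]; have injh := bij_inj bijh.
have inj : injective [the {linear V -> I 0} of res_aug I \o h].
  exact: inj_comp (@res_aug_inj _ _ I) injh.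
have ex0 x : res_diff I 0 x = 0 <-> exists v, x = (res_aug I \o h) v.
  have [h' _ h'K] := bijh; rewrite res_exact0; split=> [[w ->]|[v ->]].
    by exists (h' w); rewrite /= h'K.
  by exists (h v).
by exists (InjResolution (@res_injective _ _ I) inj ex0 (@res_exact _ _ I)), n.
Qed.

Lemma isomorphic_trans (R : comNzRingType) (V W X : lmodType R) :
  isomorphic V W -> isomorphic W X -> isomorphic V X.
Proof.
move=> [f bijf] [h bijh]; exists [the {linear V -> X} of h \o f].
exact: bij_comp.
Qed.

Lemma canonical_ideal_iso (R : comNzRingType) (m D D' : ideal R) :
  isomorphic (submod D) (submod D') -> canonical_ideal m D' -> canonical_ideal m D.
Proof.
by move=> iso [C [canC iso']]; exists C; split=> //; apply: isomorphic_trans iso'.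
Qed.

(** A principal ideal generated by a nonzerodivisor is isomorphic to [R]. *)
Lemma principal_gorenstein (R : comNzRingType) (m K : ideal R) (k0 : R) :
  canonical_ideal m K -> k0 \in K -> regular k0 ->
  (forall k : R, k \in K -> multiples k0 k) -> gorenstein R.
Proof.
move=> [C [[_ _ _ fid] iso]] Kk0 rk0 gen.
apply: (finite_injdim_iso _ fid); apply: isomorphic_trans iso.
have lin : linear (fun r : R^o => (r : R) *: (Submod Kk0 : submod K)).
  by move=> a r s; rewrite scalerDl scalerA.
exists (mk_linear lin); apply: bijective_of_inj_surj => [r s /(congr1 val)|y].
  rewrite !ideal_valZ => e; apply: (regular_inj rk0).
  by rewrite mulrC [RHS]mulrC.
have [r rE] := gen _ (valP y); exists r; apply: val_inj.
by rewrite ideal_valZ rE.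
Qed.

(** Canonical ideals are isomorphic, so the bidual of each of them can be
    computed through its embedding with image [D]. *)
Lemma bideg_intro (B : comNzRingType) (n D : ideal B) (d : B) (l : nat) :
  cohen_macaulay n 1 -> canonical_ideal n D -> d \in D -> regular d ->
  ideal_series (fun x : B => x \in n) (fun x : B => x \in D)
    (dual_ideal d (dual_ideal d (fun x : B => x \in D))) l ->
  bideg B l.
Proof.
move=> cm canD Dd rd ser; have Bn := cohen_macaulay_onedim cm.
exists n; split=> //; first by exists D.
move=> D' canD'.
have [p [q [rp rq D'D DD']]] := canonical_ideal_unique Bn (mem_is_ideal D')
  (mem_is_ideal D) (canonical_ideal_embedding cm canD')
  (canonical_ideal_embedding cm canD).
have [h [h' hK h'K]] := ideal_isomorphism rp rq D'D DD'.
pose f : {linear submod D' -> B^o} := [the {linear submod D' -> B^o} of val \o h].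
have fd : f (h' (Submod Dd)) = d by rewrite /= h'K.
have injf : injective f by move=> u v uv; apply: (can_inj hK); exact: val_inj uv.
have fD : (fun x : B => is_true (x \in D)) = (fun x : B => exists v : submod D', x = f v).
  apply: pred_ext => x; split=> [Dx|[v ->]]; last exact: (valP (h v)).
  by exists (h' (Submod Dx)); rewrite /= h'K.
apply: (bidual_length (f := f) (v0 := h' (Submod Dd)) Bn injf); rewrite fd //.
by rewrite -fD.
Qed.

Section IdealizationSeries.
Variables (R : comNzRingType) (m : ideal R) (K L : R -> Prop).
Hypothesis idL : is_ideal L.
Hypothesis LK : forall a b, L a -> b \in m -> K (a * b).

Let A : comNzRingType := idealization (submod m).
Let M : R -> Prop := fun x => x \in m.
Let MA : A -> Prop := fun x => x \in idealization_max_id m.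

Lemma pair_series_right I J n : ideal_series M I J n -> (forall x, K x -> I x) ->
  (forall x, J x -> x \in m) ->
  ideal_series MA (pair_ideal (m := m) L I) (pair_ideal L J) n.
Proof.
have idp I' : is_ideal I' -> (forall x, K x -> I' x) ->
    is_ideal (pair_ideal (m := m) L I').
  by move=> idI KI; apply: pair_ideal_ideal => // a b La mb; apply/KI/LK.
elim=> [{}I idI KI _|{}I I' {}J {}n [idI idI' II' [y [Iy nIy yM yI]]] ser IH KI Jm].
  by apply: series_nil; apply: idp.
have KI' x : K x -> I' x by move/KI/II'.
have my : y \in m by apply: Jm; apply: series_sub ser _ Iy.
apply: series_cons (IH KI' Jm); split; [exact: idp | exact: idp | |].
  by move=> al [L1 /II'].
exists (nilpart my); split.
- by split; [apply: ideal0 idL | rewrite ideal_part_nilpart].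
- by case=> _; rewrite ideal_part_nilpart.
- move=> z; rewrite /MA idealization_maxE => mz; split.
    by rewrite idealization_mul1E mulr0; apply: ideal0 idL.
  rewrite idealization_mul2E ideal_part_nilpart mul0r addr0.
  exact: yM.
move=> al [Lal /yI[c [i [Ii ali]]]].
have mi : i \in m by apply: Jm; apply: series_sub ser _ (II' _ Ii).
exists (scalar m c), ((al.1, Submod mi) : A); split=> //.
apply: idealization_ext.
  by rewrite idealization_add1E idealization_mul1E mulr0 add0r.
by rewrite idealization_add2E scalar_mul2.
Qed.

Lemma pair_series_left I J J0 n : ideal_series M I J n -> is_ideal J0 ->
  (forall x, J x -> J0 x) ->
  ideal_series MA (pair_ideal (m := m) I J0) (pair_ideal J J0) n.
Proof.
move=> + idJ0; have idp I' : is_ideal I' -> (forall x, I' x -> J0 x) ->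
    is_ideal (pair_ideal (m := m) I' J0).
  move=> idI IJ; apply: pair_ideal_ideal => // a b /IJ Ja _.
  by apply: idealMr.
elim=> [{}I idI IJ|{}I I' {}J {}n [idI idI' II' [y [Iy nIy yM yI]]] ser IH JJ].
  by apply: series_nil; apply: idp.
have I'J x : I' x -> J0 x by move/(series_sub ser)/JJ.
have IJ x : I x -> J0 x by move/II'/I'J.
apply: series_cons (IH JJ); split; [exact: idp | exact: idp | |].
  by move=> al [/II'].
exists (scalar m y); split.
- by split; [|apply: ideal0 idJ0].
- by case.
- move=> z; rewrite /MA idealization_maxE => mz; split.
    by rewrite idealization_mul1E; apply: yM.
  by rewrite mulrC scalar_mul2; apply: idealMr => //; apply: I'J.
move=> al [/yI[c [i [Ii ali]]] Jal].
exists (scalar m c), ((i, al.2) : A); split=> //.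
apply: idealization_ext; first by rewrite idealization_add1E idealization_mul1E.
by rewrite idealization_add2E scalar_mul2 ideal_part_scalar mulr0 add0r.
Qed.

End IdealizationSeries.

(** Here [L = K : m], [K' = d (R : K)], and [J] is the bidual [R : (R : K)]. *)
Section Bidegree.
Variables (R : comNzRingType) (m K : ideal R) (x d : R).
Hypotheses (cm : cohen_macaulay m 1) (canK : canonical_ideal m K).
Hypotheses (mx : x \in m) (rx : regular x).
Hypothesis Kx : forall k : R, k \in K -> multiples x k.
Hypotheses (Kd : d \in K) (rd : regular d).
Hypothesis nG : ~ gorenstein R.

Let A : comNzRingType := idealization (submod m).
Let M : R -> Prop := fun z => z \in m.
Let KP : R -> Prop := fun z => z \in K.
Let L := socle_ideal M KP.
Let K' := dual_ideal d KP.
Let J := dual_ideal d K'.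
Let Rm : onedim M := cohen_macaulay_onedim cm.
Let idK : is_ideal KP := mem_is_ideal K.
Let embK : canonically_embedded M KP := canonical_ideal_embedding cm canK.

Let nonprincipal :
  ~ exists k0, [/\ KP k0, regular k0 & forall k, KP k -> multiples k0 k].
Proof.
move=> [k0 [Kk0 rk0 gen]]; apply: nG.
exact: (principal_gorenstein canK Kk0 rk0 gen).
Qed.

Let Lgen := socle_ideal_gen idK embK mx rx Kx.
Let idL : is_ideal L := socle_ideal_ideal M idK.
Let idJ : is_ideal J := dual_ideal_ideal d K'.
Let KL := @sub_socle_ideal _ M KP idK.
Let LJ := socle_sub_bidual Rm idK embK nonprincipal rd Lgen.

Let socle_step : simple_step M KP L.
Proof.
split=> //; have [l0 [Ll0 nKl0 gen]] := Lgen.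
by exists l0; split.
Qed.

Let J_max y : J y -> y \in m.
Proof.
move=> Jy; have K'd : K' d := @dual_ideal_mem R d KP.
have [t [Mt tE]] := bidual_mul_sub_max Rm idK embK nonprincipal Kd rd Lgen Jy K'd.
suff -> : y = t by [].
by apply: (regular_inj rd); rewrite mulrC tE mulrC.
Qed.


(** The second coordinates are required to lie in [d m] and not only in [d R];
    this is automatic, as products of [R : L] with [L] lie in [m]. *)
Lemma canonical_dual_pair (al : A) :
  dual_ideal (scalar m d) (canonical_pair KP) al <-> pair_ideal K' K' al.
Proof.
have dS := dual_socle Rm idK embK nonprincipal rd Lgen.
split=> [H|[K1 K2] be [L1 K3]].
  have H1 u : L u -> multiples d (al.1 * u) /\ multiples d (ideal_part al * u).
    move=> Lu; have [|ga gaE] := H (scalar m u); first by split=> //; apply: ideal0 idK.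
    have e1 := congr1 fst gaE; have e2 := congr1 (@ideal_part R m) gaE.
    rewrite [al * _]mulrC scalar_mul2 [ga * _]mulrC scalar_mul2 in e2.
    split; first by exists ga.1.
    by exists (ideal_part ga); rewrite mulrC e2 mulrC.
  by split; apply/dS => u /H1[].
have [r rE] := (dS al.1).1 K1 be.1 L1.
have [t1 [Mt1 t1E]] := dual_mul_sub_max Rm nonprincipal rd K1 K3.
have [t2 [Mt2 t2E]] := dual_mul_socle_sub_max Rm idK embK nonprincipal rd Lgen K2 L1.
have mt : t1 + t2 \in m by apply: (idealD (mem_is_ideal m)).
exists ((r, Submod mt) : A); apply: idealization_ext; first exact: rE.
rewrite [(_ : A) * scalar m d]mulrC scalar_mul2 idealization_mul2E t1E.
by rewrite [be.1 * _]mulrC t2E -mulrDl mulrC.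
Qed.

Lemma canonical_bidual_pair (al : A) :
  dual_ideal (scalar m d) (dual_ideal (scalar m d) (canonical_pair KP)) al <->
  pair_ideal J J al.
Proof.
have K'0 : K' 0 := ideal0 (dual_ideal_ideal d KP).
split=> [H|[J1 J2] be /canonical_dual_pair[K1 K2]].
  have H1 u : K' u -> multiples d (al.1 * u) /\ multiples d (ideal_part al * u).
    move=> Ku; have [|ga gaE] := H (scalar m u).
      by apply/canonical_dual_pair.
    have e1 := congr1 fst gaE; have e2 := congr1 (@ideal_part R m) gaE.
    rewrite [al * _]mulrC scalar_mul2 [ga * _]mulrC scalar_mul2 in e2.
    split; first by exists ga.1.
    by exists (ideal_part ga); rewrite mulrC e2 mulrC.
  by split=> u /H1[].
have [r rE] := J1 _ K1.
have [t1 [Mt1 t1E]] := bidual_mul_sub_max Rm idK embK nonprincipal Kd rd Lgen J1 K2.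
have [t2 [Mt2 t2E]] := bidual_mul_sub_max Rm idK embK nonprincipal Kd rd Lgen J2 K1.
have mt : t1 + t2 \in m by apply: (idealD (mem_is_ideal m)).
exists ((r, Submod mt) : A); apply: idealization_ext; first exact: rE.
rewrite [(_ : A) * scalar m d]mulrC scalar_mul2 idealization_mul2E t1E.
by rewrite [be.1 * _]mulrC t2E -mulrDl mulrC.
Qed.

Lemma bideg_idealization :
  exists n, bideg R n.+1 /\ bideg A (n.+1 + n).
Proof.
have fL : faithful L by apply: regular_faithful rd; apply: KL.
have [n serLJ] := series_exists Rm idL idJ fL LJ.
have serKJ : ideal_series M KP J n.+1 by apply: series_cons serLJ.
exists n; split; first exact: (bideg_intro cm canK Kd rd serKJ).
have [E [Z [g [e1 [e0 emb]]]]] := embK.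
have canD : canonical_ideal (idealization_max_id m) (canonical_pair_id m idK).
  exact: (pair_canonical_ideal cm idK emb mx rx Kx).
have DE : (fun al : A => is_true (al \in canonical_pair_id m idK)) = pair_ideal L KP.
  by apply: pred_ext => al; apply: (mk_idealE (canonical_pair_ideal m idK)).
have LK a b : L a -> b \in m -> KP (a * b).
  by move=> La mb; rewrite mulrC; apply: La.
apply: (bideg_intro (d := scalar m d) (idealization_cohen_macaulay cm) canD).
- apply/(mk_idealE (canonical_pair_ideal m idK)).
  by split; [apply: KL | apply: ideal0 idK].
- exact: scalar_regular.
rewrite DE.
have -> : dual_ideal (scalar m d) (dual_ideal (scalar m d) (pair_ideal L KP)) =
    pair_ideal (m := m) J J.
  by apply: pred_ext => al; apply: canonical_bidual_pair.
apply: (series_cat (J := pair_ideal (m := m) L J)).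
  by apply: (pair_series_right idL LK serKJ).
exact: (pair_series_left serLJ idJ).
Qed.

End Bidegree.

(** The maximal ideal in the definition of the bidegree is determined by the
    ring, so both lengths are those of the same module. *)
Lemma goto_bideg_unique (R : comNzRingType) (m : ideal R) n :
  cohen_macaulay m 1 -> (exists C, canonical_ideal m C) ->
  bideg R n.+1 -> goto_ring R -> n = 0%N.
Proof.
move=> [[maxm _] _ _ _] [C canC] [m1 [[[_ loc1] _ _ _] _ H]] [m2 [[[_ loc2] _ _ _] _ H']].
have e1 : m = m1 by apply/submodClosed_ext/loc1.
have e2 : m = m2 by apply/submodClosed_ext/loc2.
subst m1 m2; exact: length_one_unique (H' C canC) (H C canC).
Qed.

Theorem proposition9p1 (R : comNzRingType) (m : ideal R) :
  cohen_macaulay m 1 ->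
  (exists C : ideal R, canonical_ideal m C) ->
  ~ gorenstein R ->
  let A : comNzRingType := idealization (submod m) in
  (exists r s : nat,
     [/\ bideg R r, bideg A s & (s%:Z = 2 * r%:Z - 1)]) /\
  (goto_ring R -> goto_ring A).
Proof.
move=> cm [C canC] nG A; have Rm := cohen_macaulay_onedim cm.
have [x [mx rx]] := onedim_regular Rm.
(* Replacing [C] by [x C] brings [C : m] inside [R]. *)
have idK : is_ideal (fun k : R => exists c, c \in C /\ k = x * c).
  have idC := mem_is_ideal C.
  split; first by exists 0; rewrite mulr0; split=> //; apply: ideal0 idC.
  move=> a _ _ [c [Cc ->]] [c' [Cc' ->]]; exists (a * c + c').
  by split; [apply: (idC.2) | ring].
have canK : canonical_ideal m (mk_ideal idK).
  apply: (canonical_ideal_iso _ canC).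
  apply: (@ideal_isomorphism _ _ _ 1 x) => //.
  - by move=> y; rewrite mul1r.
  - by move=> k /(mk_idealE idK)[c [Cc ->]]; exists c; rewrite mul1r.
  - move=> c Cc; exists (x * c); rewrite mul1r; split=> //.
    by apply/(mk_idealE idK); exists c.
have [d [Kd rd]] := canonical_regular Rm (mem_is_ideal _)
  (canonical_ideal_embedding cm canK).
have Kx (k : R) : k \in mk_ideal idK -> multiples x k.
  by move=> /(mk_idealE idK)[c [_ ->]]; exists c; rewrite mulrC.
have [n [bR bA]] := bideg_idealization cm canK mx rx Kx Kd rd nG.
split; first by exists n.+1, (n.+1 + n)%N; split=> //; lia.
move=> goto; rewrite /goto_ring.
have n0 := goto_bideg_unique cm (ex_intro _ C canC) bR goto.
by rewrite n0 in bA.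
Qed.
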